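(* Assume that $\varepsilon=1$ and that $D^1$ is infinite. Let $M$ be a $-1$-hermitian hyperbolic module over $(D,J)$. There exists a unique cohomology class $[\widetilde{\mathsf m}]\in H^2(\mathbf{EU}(M);I\!I(D,J))$ which maps under the coefficient homomorphism $I\!I(D,J)\to W^1(D,J)$ onto (the restriction to $\mathbf{EU}(M)$ of) the Maslov class $[\mathsf m]$.
   Context: $D$ is a field or division ring of arbitrary characteristic with an involution $J$ (an antiautomorphism with $J^2=\mathrm{id}$; $J=\mathrm{id}$ is allowed if $D$ is commutative), and $D^1=\{a\in D\mid a=a^J\}$. Modules are finite dimensional right $D$-modules. For a matrix $a$, $a^J$ denotes the transpose with $J$ applied to all entries. For $\delta=\pm1$, a $\delta$-hermitian form on $M$ is a biadditive map $h:M\times M\to D$ with $h(ua,vb)=a^Jh(u,v)b$ and $h(u,v)=h(v,u)^J\delta$. For a right $D$-module $X$, $X^J$ is its dual space made into a right $D$-module by $(\xi a)(v)=a^J\xi(v)$. The hyperbolic $\delta$-hermitian module on $X$ is $X\oplus X^J$ with $h_X((x,\xi),(y,\eta))=\xi(y)+\eta(x)^J\delta$; every isometric module is also called hyperbolic, of rank $\dim X$. $\mathbf U(M)$ is the isometry group of $(M,h)$. $\mathbf{EU}(M)\subseteq\mathbf U(M)$ is the normal subgroup generated by the Eichler transformations, i.e. the isometries $v\mapsto v+w\,h(u,v)+u\,h(w,v)+u\,a\,h(u,v)$, where $u\in M$ with $h(u,u)=0$, $w\in M$ with $h(u,w)=0$, and $a\in D$ with $a-a^J=h(w,w)$. The Witt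 group $W^1(D,J)$ is the group completion of the monoid of isomorphism classes of nondegenerate $1$-hermitian forms over $(D,J)$ modulo the subgroup generated by the $1$-hermitian hyperbolic modules; $[t]$ is the class of the form with matrix $t$. $I\!I(D,J)\subseteq W^1(D,J)$ is the subgroup generated by all $[t]$ with $\dim(t)\in4\mathbb Z$ and $\det(t)=1$, where $\det$ takes values in $K_1(D)$, the abelianization of $D^*$. A Lagrangian is a subspace $X$ with $X=X^\perp$; two Lagrangians $X,Y$ are opposite if $X\cap Y=0$. For pairwise opposite Lagrangians $X,Y,Z$ in $M$ (rank $n$), choose a basis $x_1,\dots,x_n$ of $X$ and let $y_1,\dots,y_n$ be the basis of $Y$ with $h(y_\mu,x_\nu)=\delta_{\mu\nu}$; then $Z$ has a unique basis $y_\nu+\sum_\mu x_\mu t_{\mu\nu}$ with $t$ nonsingular and $t=t^J$, and $\kappa(X,Y,Z)$ is the isomorphism class of $t$ (well defined). The opposition graph $\Gamma$ of $M$ has the Lagrangians as vertices and pairs of opposite Lagrangians as edges. $Fl(\Gamma)$ is the simplicial set whose $k$-simplices are tuples of vertices that are pairwise equal or adjacent, with $\mathbb Z$-free chain complex $C_*$, and $\tilde C_*$ is its quotient complex of alternating chains $\langle x_0,\dots,x_k\rangle$ (antisymmetric, zero if two entries coincide). The Maslov cocycle is the $\mathbf U(M)$-invariant $2$-cocycle $\mathsf m:\langle X,Y,Z\rangle\mapsto[\kappa(X,Y,Z)]\in W^1(D,J)$. For a group $G$ acting on $C_*$, a projective resolution $P_*\to\mathbb Z$ of $G$ with augmentation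 $\eta:P_0\to\mathbb Z$, and a trivial coefficient group $A$, $H^*_G(C_*;A)$ is the cohomology of $\mathrm{Hom}_{\mathbb Z}(P_*\otimes_GC_*,A)$; a $G$-invariant cochain $c$ is viewed as $p\otimes z\mapsto\eta(p)c(z)$ on $P_0\otimes_GC_*$ (zero on the other components). If $D^1$ is infinite, $Fl(\Gamma)$ is acyclic and the constant map $Fl(\Gamma)\to pt$ induces $H^*(\mathbf U(M);A)\cong H^*_{\mathbf U(M)}(Fl(\Gamma);A)$; via this isomorphism $\mathsf m$ defines the Maslov class $[\mathsf m]\in H^2(\mathbf U(M);W^1(D,J))$, and its restriction to $H^2(\mathbf{EU}(M);W^1(D,J))$ is also denoted $[\mathsf m]$. *)

(* Defs.v *)
From HB Require Import structures.
From mathcomp Require Import all_boot all_order all_algebra.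
From mathcomp Require Import all_classical.
From mathcomp Require Import freeg.

Set Implicit Arguments.
Unset Strict Implicit.
Unset Printing Implicit Defensive.

Import GRing.Theory.
Local Open Scope ring_scope.
Local Open Scope quotient_scope.
Local Open Scope classical_set_scope.

Section GeneratedSubgroup.
Variables (V : zmodType) (S : set V).

Definition zspan : {pred V} := fun x =>
  `[< forall K : set V, (forall y, S y -> K y) -> K 0 ->
        (forall y z, K y -> K z -> K (y - z)) -> K x >].

Lemma zspan_zmod_closed : zmod_closed zspan.
Proof.
split=> [|x y /asboolP Hx /asboolP Hy]; apply/asboolP => K KS K0 KB //.
by apply: (KB); [exact: (Hx K KS K0 KB) | exact: (Hy K KS K0 KB)].
Qed.
HB.instance Definition _ := GRing.isZmodClosed.Build V zspan zspan_zmod_closed.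

Definition zspan_sub := {x : V | zspan x}.
HB.instance Definition _ := SubChoice.on zspan_sub.
HB.instance Definition _ := [SubChoice_isSubZmodule of zspan_sub by <:].
End GeneratedSubgroup.

(* All degrees live in a single ambient group, [deg n] being the group of
   n-cochains.  This avoids casts between the components of a total complex. *)
Record cochain_complex := CochainComplex {
  cochain :> zmodType;
  deg : nat -> {pred cochain};
  deg_zmod_closed : forall n, zmod_closed (deg n);
  diff : {additive cochain -> cochain};
  diff_deg : forall n f, f \in deg n -> diff f \in deg n.+1;
  diffK : forall n f, f \in deg n -> diff (diff f) = 0
}.
Arguments deg {_} n.
Arguments diff {_}.

Section Cohomology.
Variables (K : cochain_complex) (n : nat).

Definition cocycle : {pred K} := fun f => (f \in deg n) && (diff f == 0).

Lemma cocycle_zmod_closed : zmod_closed cocycle.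
Proof.
have [d0 dB] := @deg_zmod_closed K n.
split=> [|x y /andP[xd /eqP x0] /andP[yd /eqP y0]]; apply/andP; split=> //.
- by rewrite raddf0.
- exact: dB.
- by rewrite raddfB x0 y0 subrr.
Qed.
HB.instance Definition _ :=
  GRing.isZmodClosed.Build K cocycle cocycle_zmod_closed.

Definition cocycles := {f : K | cocycle f}.
HB.instance Definition _ := SubChoice.on cocycles.
HB.instance Definition _ := [SubChoice_isSubZmodule of cocycles by <:].

(* The disjunct z = 0 is only needed in degree n = 0. *)
Definition coboundary : {pred cocycles} := fun z =>
  (z == 0) ||
  `[< exists k (b : K), [/\ k.+1 = n, b \in deg k & diff b = val z] >].

Lemma coboundary_zmod_closed : zmod_closed coboundary.
Proof.
split=> [|x y]; first by apply/orP; left.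
case/orP=> [/eqP-> | /asboolP[k [b [kn bk dbx]]]].
  case/orP=> [/eqP-> | /asboolP[k [b [kn bk dby]]]].
    by apply/orP; left; rewrite subrr.
  apply/orP; right; apply/asboolP; exists k, (- b); split=> //.
    have [d0 dB] := @deg_zmod_closed K k.
    by rewrite -[- b]add0r dB.
  by rewrite sub0r !raddfN dby.
have [d0 dB] := @deg_zmod_closed K k.
case/orP=> [/eqP-> | /asboolP[k' [b' [kn' bk' dby]]]].
  by rewrite subr0; apply/orP; right; apply/asboolP; exists k, b.
apply/orP; right; apply/asboolP; exists k, (b - b'); split=> //.
  by move: kn'; rewrite -kn => -[ek]; rewrite dB // -ek.
by rewrite raddfB dbx dby.
Qed.
HB.instance Definition _ :=
  GRing.isZmodClosed.Build cocycles coboundary coboundary_zmod_closed.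

Definition cohomology := Quotient.quot coboundary.
HB.instance Definition _ := GRing.Zmodule.on cohomology.

Definition cclass (z : cocycles) : cohomology := \pi z.

Lemma cclassP (z z' : cocycles) :
  cclass z = cclass z' <-> z - z' \in coboundary.
Proof.
by rewrite Quotient.idealrBE; split=> /eqP.
Qed.
End Cohomology.

Record cochain_map (K L : cochain_complex) := CochainMap {
  cmap :> {additive K -> L};
  cmap_deg : forall n f, f \in deg n -> cmap f \in deg n;
  cmap_diff : forall f, cmap (diff f) = diff (cmap f)
}.

Section CohomologyMap.
Variables (K L : cochain_complex) (phi : cochain_map K L) (n : nat).

Lemma cmap_cocycle (z : cocycles K n) : cocycle n (phi (val z)).
Proof.
case: z => f /= /andP[fn /eqP df].
by rewrite /cocycle cmap_deg //= -cmap_diff df raddf0 eqxx.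
Qed.

Definition cmap_cocycles (z : cocycles K n) : cocycles L n :=
  exist _ (phi (val z)) (cmap_cocycle z).

Definition cohomology_map (c : cohomology K n) : cohomology L n :=
  cclass (cmap_cocycles (repr c)).

Lemma cohomology_mapE (z : cocycles K n) :
  cohomology_map (cclass z) = cclass (cmap_cocycles z).
Proof.
apply/cclassP.
have : repr (cclass z) - z \in @coboundary K n.
  by apply/cclassP; rewrite {1}/cclass reprK.
case/orP=> [/eqP/(congr1 val) /=|/asboolP[k [b [kn bk db]]]].
  move=> e0; apply/orP; left; apply/eqP/val_inj => /=.
  by rewrite -raddfB e0 raddf0.
apply/orP; right; apply/asboolP; exists k, (phi b).
split=> //; first exact: cmap_deg.
by rewrite -cmap_diff db [X in phi X]raddfB raddfB.
Qed.
End CohomologyMap.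

Definition face (T : Type) (i : nat) (s : seq T) := take i s ++ drop i.+1 s.

Definition altsum (T : Type) (A : zmodType) (f : seq T -> A) (s : seq T) : A :=
  \sum_(i < size s) f (face i s) *~ (-1) ^+ i.

Lemma fctB (T : Type) (A : zmodType) (f g : T -> A) x : (f - g) x = f x - g x.
Proof. by []. Qed.

Section AltSum.
Variables (T : Type) (A : zmodType).
Implicit Types (f g : seq T -> A) (s : seq T).

Lemma size_face i s : (i < size s)%N -> size (face i s) = (size s).-1.
Proof.
move=> lt_i; rewrite size_cat size_takel ?(ltnW lt_i) // size_drop.
by rewrite -{2}(subnKC lt_i) addSn.
Qed.

Lemma face_map T' (k : T -> T') i s : face i (map k s) = map k (face i s).
Proof. by rewrite /face map_cat map_take map_drop. Qed.

Lemma mem_face (T' : eqType) i (s : seq T') x : x \in face i s -> x \in s.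
Proof.
by rewrite mem_cat => /orP[/mem_take //|/mem_drop].
Qed.

Lemma altsum_nil f : altsum f [::] = 0.
Proof. by rewrite /altsum big_ord0. Qed.

Lemma altsum_cons f x s :
  altsum f (x :: s) = f s - altsum (fun u => f (x :: u)) s.
Proof.
rewrite /altsum /= big_ord_recl /face /= drop0 expr0 mulr1z; congr (_ + _).
rewrite -sumrN; apply: eq_bigr => i _.
by rewrite /bump /= add1n exprS mulN1r mulrNz.
Qed.

Lemma eq_altsum f g s :
  (forall i, (i < size s)%N -> f (face i s) = g (face i s)) ->
  altsum f s = altsum g s.
Proof. by move=> fg; apply: eq_bigr => i _; rewrite fg. Qed.

Lemma altsumD f g s : altsum (fun u => f u + g u) s = altsum f s + altsum g s.
Proof. by rewrite -big_split; apply: eq_bigr => i _; rewrite mulrzDl. Qed.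

Lemma altsumN f s : altsum (fun u => - f u) s = - altsum f s.
Proof. by rewrite -sumrN; apply: eq_bigr => i _; rewrite mulNrz. Qed.

Lemma altsumB f g s : altsum (fun u => f u - g u) s = altsum f s - altsum g s.
Proof. by rewrite altsumD altsumN. Qed.

Lemma altsumMz f m s : altsum (fun u => f u *~ m) s = altsum f s *~ m.
Proof. by rewrite mulrz_suml; apply: eq_bigr => i _; rewrite mulrzAC. Qed.

Lemma altsum0 f s :
  (forall i, (i < size s)%N -> f (face i s) = 0) -> altsum f s = 0.
Proof. by move=> f0; rewrite /altsum big1 // => i _; rewrite f0 // mul0rz. Qed.

Lemma altsumK f s : altsum (altsum f) s = 0.
Proof.
elim: s f => [|x s IH] f; first exact: altsum_nil.
rewrite altsum_cons (_ : (fun u => _) = fun u => f u - altsum (fun w => f (x :: w)) u).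
  by rewrite altsumB IH subr0 subrr.
by apply/funext => u; rewrite altsum_cons.
Qed.
End AltSum.

Lemma altsum_exchange (T T' : Type) (A : zmodType) (f : seq T -> seq T' -> A) s v :
  altsum (fun s' => altsum (f s') v) s = altsum (fun v' => altsum (f^~ v') s) v.
Proof.
rewrite /altsum; under eq_bigr do rewrite mulrz_suml.
rewrite exchange_big; apply: eq_bigr => j _.
by rewrite mulrz_suml; apply: eq_bigr => i _; rewrite mulrzAC.
Qed.

Lemma altsum_morph (T : Type) (A B : zmodType) (phi : {additive A -> B})
    (f : seq T -> A) s : altsum (phi \o f) s = phi (altsum f s).
Proof. by rewrite raddf_sum; apply: eq_bigr => i _; rewrite raddfMz. Qed.

Section GroupCohomology.
Variables (G : groupType) (A : zmodType).

(* The standard resolution P_n = Z[G^(n+1)] of Z over G; a homomorphism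
   P_n -> A is a function on sequences of length n+1 (extended by 0). *)
Definition gdeg n : {pred seq G -> A} := fun f =>
  `[< (forall s, size s <> n.+1 -> f s = 0) /\
      (forall k s, f [seq (k * x)%g | x <- s] = f s) >].

Definition gdiff (f : seq G -> A) : seq G -> A := altsum f.

Lemma gdeg_zmod_closed n : zmod_closed (gdeg n).
Proof.
split=> [|f g /asboolP[f0 fG] /asboolP[g0 gG]]; apply/asboolP; split=> //.
  by move=> s ns; rewrite fctB f0 // g0 // subrr.
by move=> k s; rewrite fctB fG gG.
Qed.

Lemma gdiff_zmod_morphism : zmod_morphism gdiff.
Proof. by move=> f g; apply/funext => s; rewrite fctB -altsumB. Qed.
HB.instance Definition _ := GRing.isZmodMorphism.Build
  (seq G -> A) (seq G -> A) gdiff gdiff_zmod_morphism.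

Lemma gdiff_deg n f : f \in gdeg n -> gdiff f \in gdeg n.+1.
Proof.
move=> /asboolP[f0 fG]; apply/asboolP; split=> [s ns|k s].
  apply: altsum0 => i lti; rewrite f0 // size_face //.
  by case: s ns lti => //= x s ns _ es; apply: ns; rewrite es.
by rewrite /gdiff /altsum size_map; apply: eq_bigr => i _; rewrite face_map fG.
Qed.

Lemma gdiffK n f : f \in gdeg n -> gdiff (gdiff f) = 0.
Proof. by move=> _; apply/funext => s; exact: altsumK. Qed.

Definition gcomplex : cochain_complex :=
  CochainComplex gdeg_zmod_closed gdiff_deg gdiffK.

Definition gcohomology n := cohomology gcomplex n.
HB.instance Definition _ n := GRing.Zmodule.on (gcohomology n).
End GroupCohomology.

Section Coefficients.
Variables (G : groupType) (A B : zmodType) (phi : {additive A -> B}).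

Definition coef_cochain (f : gcomplex G A) : gcomplex G B := fun s => phi (f s).

Lemma coef_cochainB : zmod_morphism coef_cochain.
Proof. by move=> f g; apply/funext => s; rewrite /coef_cochain !fctB raddfB. Qed.
HB.instance Definition _ := GRing.isZmodMorphism.Build
  (gcomplex G A) (gcomplex G B) coef_cochain coef_cochainB.

Lemma coef_cochain_deg n f : f \in deg n -> coef_cochain f \in deg n.
Proof.
move=> /asboolP[f0 fG]; apply/asboolP; split=> [s ns|k s].
  by rewrite /coef_cochain f0 // raddf0.
by rewrite /coef_cochain fG.
Qed.

Lemma coef_cochain_diff f : coef_cochain (diff f) = diff (coef_cochain f).
Proof. by apply/funext => s; exact/esym/altsum_morph. Qed.

Definition coef_cmap : cochain_map (gcomplex G A) (gcomplex G B) :=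
  CochainMap coef_cochain_deg coef_cochain_diff.

Definition coef_hom n : gcohomology G A n -> gcohomology G B n :=
  @cohomology_map _ _ coef_cmap n.
End Coefficients.

Section Restriction.
Variables (H G : groupType) (iota : {multiplicative H -> G}) (A : zmodType).

Definition res_cochain (f : gcomplex G A) : gcomplex H A :=
  fun s => f (map iota s).

Lemma res_cochainB : zmod_morphism res_cochain.
Proof. by []. Qed.
HB.instance Definition _ := GRing.isZmodMorphism.Build
  (gcomplex G A) (gcomplex H A) res_cochain res_cochainB.

Lemma res_cochain_deg n f : f \in deg n -> res_cochain f \in deg n.
Proof.
move=> /asboolP[f0 fG]; apply/asboolP; split=> [s ns|k s].
  by rewrite /res_cochain f0 ?size_map.
rewrite /res_cochain -[RHS](fG (iota k)) -!map_comp; congr f.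
by apply: eq_map => x /=; rewrite gmulfM.
Qed.

Lemma res_cochain_diff f : res_cochain (diff f) = diff (res_cochain f).
Proof.
apply/funext => s; rewrite /res_cochain /= /gdiff /altsum size_map.
by apply: eq_bigr => i _; rewrite face_map.
Qed.

Definition res_cmap : cochain_map (gcomplex G A) (gcomplex H A) :=
  CochainMap res_cochain_deg res_cochain_diff.

Definition res_hom n : gcohomology G A n -> gcohomology H A n :=
  @cohomology_map _ _ res_cmap n.
End Restriction.

Record Ggraph (G : groupType) := GGraph {
  vertex :> choiceType;
  gact : G -> vertex -> vertex;
  gact1 : forall x, gact 1%g x = x;
  gactM : forall k l x, gact (k * l)%g x = gact k (gact l x);
  adj : vertex -> vertex -> Prop;
  adj_gact : forall k x y, adj x y -> adj (gact k x) (gact k y)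
}.

Section EquivariantCohomology.
Variables (G : groupType) (Gam : Ggraph G) (A : zmodType).

(* A k-simplex of Fl is a nonempty sequence of length k+1 satisfying this. *)
Definition flag (v : seq Gam) : bool :=
  `[< forall x y, x \in v -> y \in v -> x = y \/ adj x y >].

Lemma flag_face i v : flag v -> flag (face i v).
Proof.
move=> /asboolP vf; apply/asboolP => x y /mem_face xv /mem_face yv.
exact: vf.
Qed.

Lemma flag_gact k v : flag v -> flag (map (gact k) v).
Proof.
move=> /asboolP vf; apply/asboolP => _ _ /mapP[x xv ->] /mapP[y yv ->].
by case: (vf x y xv yv) => [->|/(adj_gact k)]; [left | right].
Qed.

Lemma flag_gactE k v : flag (map (gact k) v) = flag v.
Proof.
apply/idP/idP; last exact: flag_gact.
move/(flag_gact (k^-1)%g); rewrite -map_comp (_ : map _ v = v) //.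
by rewrite -[RHS]map_id; apply: eq_map => x /=; rewrite -gactM mulVg gact1.
Qed.

(* With P_* the standard resolution, P_p (x) C_q is Z-free on the pairs (s, v)
   with s in G^(p+1) and v a q-simplex, permuted diagonally by G; hence
   Hom_Z(P_p (x)_G C_q, A) is the group of invariant functions of (s, v). *)
Definition eqdeg n : {pred seq G -> seq Gam -> A} := fun f =>
  `[< (forall s v, ~~ [&& 0 < size s, 0 < size v, size s + size v == n.+2
                       & flag v]%N -> f s v = 0) /\
      (forall k s v, f [seq (k * x)%g | x <- s] (map (gact k) v) = f s v) >].

(* Dual of d(p (x) z) = dp (x) z + (-1)^(deg p) p (x) dz. *)
Definition eqdiff (f : seq G -> seq Gam -> A) : seq G -> seq Gam -> A :=
  fun s v => if flag v
    then altsum (f^~ v) s + altsum (f s) v *~ (-1) ^+ (size s).-1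
    else 0.

Lemma eqdeg_zmod_closed n : zmod_closed (eqdeg n).
Proof.
split=> [|f g /asboolP[f0 fG] /asboolP[g0 gG]]; apply/asboolP; split=> //.
  by move=> s v ns; rewrite !fctB f0 // g0 // subrr.
by move=> k s v; rewrite !fctB fG gG.
Qed.

Lemma eqdiff_zmod_morphism : zmod_morphism eqdiff.
Proof.
move=> f g; apply/funext => s; apply/funext => v; rewrite !fctB /eqdiff.
case: ifP => _; last by rewrite subrr.
rewrite (altsumB (f^~ v) (g^~ v)) (altsumB (f s) (g s)) mulrzBl.
by rewrite opprD addrACA.
Qed.
HB.instance Definition _ := GRing.isZmodMorphism.Build
  (seq G -> seq Gam -> A) (seq G -> seq Gam -> A) eqdiff eqdiff_zmod_morphism.

Lemma eqdiff_deg n f : f \in eqdeg n -> eqdiff f \in eqdeg n.+1.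
Proof.
move=> /asboolP[f0 fG]; apply/asboolP; split=> [s v ns|k s v]; last first.
  rewrite /eqdiff flag_gactE size_map; case: ifP => // _.
  rewrite /altsum !size_map; congr (_ + _ *~ _);
    by apply: eq_bigr => i _; rewrite face_map fG.
rewrite /eqdiff; case: ifP => // fv; rewrite fv andbT in ns.
rewrite [X in X + _]altsum0 ?add0r => [|i lti].
  rewrite altsum0 ?mul0rz // => i lti; apply: f0; apply: contra ns.
  rewrite size_face // => /and4P[-> v0 /eqP e _]; apply/andP; split=> //.
  by case: (size v) lti e => // m _ /=; rewrite addnS => ->; apply/eqP.
apply: f0; apply: contra ns.
rewrite size_face // => /and4P[s0 -> /eqP e _] /=.
by case: (size s) lti e => // m _ /=; rewrite addSn => ->; apply/eqP.
Qed.

Lemma eqdiffK n f : f \in eqdeg n -> eqdiff (eqdiff f) = 0.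
Proof.
move=> /asboolP[f0 _]; apply/funext => s; apply/funext => v.
rewrite {1}/eqdiff; case: ifP => // fv; rewrite [RHS]/=.
pose e (u : seq G) : int := (-1) ^+ (size u).-1.
have -> : altsum ((eqdiff f)^~ v) s =
    altsum (altsum (f^~ v)) s - altsum (fun u => altsum (f u) v) s *~ e s.
  rewrite -altsumMz -altsumB; apply: eq_altsum => i lti.
  rewrite /eqdiff fv; congr (_ + _); rewrite size_face //.
  rewrite /e; case: s lti => // x [|y s] lti /=.
    rewrite altsum0 ?mul0rz ?oppr0 // => j _; apply: f0.
    by case: i lti.
  by rewrite exprS mulN1r mulrNz opprK.
have -> : altsum (eqdiff f s) v =
    altsum (fun w => altsum (f^~ w) s) v + altsum (altsum (f s)) v *~ e s.
  rewrite -altsumMz -altsumD; apply: eq_altsum => i lti.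
  by rewrite /eqdiff flag_face.
by rewrite !altsumK mul0rz addr0 sub0r altsum_exchange addNr.
Qed.

Definition eqcomplex : cochain_complex :=
  CochainComplex eqdeg_zmod_closed eqdiff_deg eqdiffK.

Definition eqcohomology n := cohomology eqcomplex n.
HB.instance Definition _ n := GRing.Zmodule.on (eqcohomology n).

(* The map H^*(G; A) -> H^*_G(Fl; A) induced by Fl -> pt, that is by the
   augmentation C_0 -> Z: (p, x) |-> f p on P_n (x) C_0, zero elsewhere. *)
Definition aug_cochain (f : gcomplex G A) : eqcomplex :=
  fun s v => if size v == 1 then f s else 0.

Lemma aug_cochainB : zmod_morphism aug_cochain.
Proof.
move=> f g; apply/funext => s; apply/funext => v; rewrite !fctB /aug_cochain.
by case: eqP; rewrite ?subrr.
Qed.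
HB.instance Definition _ := GRing.isZmodMorphism.Build
  (gcomplex G A) eqcomplex aug_cochain aug_cochainB.

Lemma flag1 x : flag [:: x].
Proof. by apply/asboolP => y z; rewrite !inE => /eqP-> /eqP->; left. Qed.

Lemma aug_cochain_deg n f : f \in deg n -> aug_cochain f \in deg n.
Proof.
move=> /asboolP[f0 fG]; apply/asboolP; split=> [s v|k s v]; last first.
  by rewrite /aug_cochain size_map fG.
rewrite /aug_cochain; case: v => [|x [|y v]] //= ns; apply: f0 => es.
by move: ns; rewrite es flag1 addn1 eqxx.
Qed.

Lemma aug_cochain_diff f : aug_cochain (diff f) = diff (aug_cochain f).
Proof.
apply/funext => s; apply/funext => -[|x [|y v]]; rewrite /= /eqdiff.
- by case: ifP => // _; rewrite altsum_nil mul0rz addr0 altsum0.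
- by rewrite flag1 altsum_cons altsum_nil subr0 [aug_cochain f s [::]]/= mul0rz addr0.
- case: ifP => // _; rewrite altsum0 // add0r !altsum_cons.
  by rewrite [altsum _ v]altsum0 // subr0 subrr mul0rz.
Qed.

Definition aug_cmap : cochain_map (gcomplex G A) eqcomplex :=
  CochainMap aug_cochain_deg aug_cochain_diff.

Definition aug_hom n : gcohomology G A n -> eqcohomology n :=
  @cohomology_map _ _ aug_cmap n.
End EquivariantCohomology.

Record involution (D : pzRingType) := Involution {
  inv_fun :> D -> D;
  invoD : forall a b, inv_fun (a + b) = inv_fun a + inv_fun b;
  invoM : forall a b, inv_fun (a * b) = inv_fun b * inv_fun a;
  invoK : forall a, inv_fun (inv_fun a) = a
}.

Lemma invo1 (D : pzRingType) (J : involution D) : J 1 = 1.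
Proof. by rewrite -[J 1]mul1r -{1}(invoK J 1) -invoM mul1r invoK. Qed.

(* A right D-module is a left module over the converse ring D^c; v *> a is the
   right multiple of v by a. *)
Definition rscale (D : pzRingType) (M : lmodType D^c) (v : M) (a : D) : M :=
  (a : D^c) *: v.
Notation "v *> a" := (rscale v a) (at level 40, left associativity) : ring_scope.

(* The dual space X^J; (D^c)^o is D as a right module over itself. *)
Definition dual (D : nzRingType) (J : involution D) (X : vectType D^c) : Type :=
  'Hom(X, (D^c)^o).

Section HermitianForms.
Variables (D : nzRingType) (J : involution D).

Definition delta_hermitian (delta : D) (M : lmodType D^c) (h : M -> M -> D) : Prop :=
  [/\ forall u u' v, h (u + u') v = h u v + h u' v,
      forall u v v', h u (v + v') = h u v + h u v',
      forall u v a b, h (u *> a) (v *> b) = J a * h u v * b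
    & forall u v, h u v = J (h v u) * delta].

Section Dual.
Variable X : vectType D^c.
Local Notation dual := (dual J).
HB.instance Definition _ := GRing.Zmodule.copy (dual X) 'Hom(X, (D^c)^o).

Definition dual_eval (xi : dual X) (v : X) : D := (xi : 'Hom(X, (D^c)^o)) v.

Definition dual_scale_fun (a : D^c) (xi : dual X) (v : X) : (D^c)^o :=
  J (a : D) * dual_eval xi v.

Lemma dual_scale_linear a xi : linear (dual_scale_fun a xi).
Proof.
move=> b u v; rewrite /dual_scale_fun /dual_eval linearP.
by rewrite [J a * _]mulrDr [J a * _]mulrA.
Qed.
HB.instance Definition _ a xi := GRing.isLinear.Build D^c X (D^c)^o *:%R
  (dual_scale_fun a xi) (dual_scale_linear a xi).

Definition dual_scale (a : D^c) (xi : dual X) : dual X :=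
  linfun (dual_scale_fun a xi).

Lemma dual_scaleE a xi v : dual_eval (dual_scale a xi) v = J a * dual_eval xi v.
Proof. by rewrite /dual_eval /dual_scale lfunE. Qed.

Lemma dual_evalP (xi eta : dual X) : dual_eval xi =1 dual_eval eta -> xi = eta.
Proof. by move=> e; apply/lfunP. Qed.

Lemma dual_evalD (xi eta : dual X) v :
  dual_eval (xi + eta) v = dual_eval xi v + dual_eval eta v.
Proof. exact: (@add_lfunE _ X (D^c)^o). Qed.

Lemma dual_scaleA a b xi : dual_scale a (dual_scale b xi) = dual_scale (a * b) xi.
Proof.
apply: dual_evalP => v; rewrite !dual_scaleE.
by rewrite [J (a * b)](invoM J (b : D) (a : D)) mulrA.
Qed.

Lemma dual_scale1 : left_id 1 dual_scale.
Proof.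
by move=> xi; apply: dual_evalP => v; rewrite dual_scaleE [J 1]invo1 mul1r.
Qed.

Lemma dual_scaleDr : right_distributive dual_scale +%R.
Proof.
move=> a xi eta; apply: dual_evalP => v.
by rewrite dual_evalD !dual_scaleE dual_evalD mulrDr.
Qed.

Lemma dual_scaleDl xi : {morph dual_scale^~ xi : a b / a + b}.
Proof.
move=> a b; apply: dual_evalP => v.
by rewrite dual_evalD !dual_scaleE [J (a + b)]invoD mulrDl.
Qed.

HB.instance Definition _ := GRing.Zmodule_isLmodule.Build D^c (dual X)
  dual_scaleA dual_scale1 dual_scaleDr dual_scaleDl.
End Dual.

Definition hyperbolic_form (delta : D) (X : vectType D^c) (u v : X * dual J X) : D :=
  dual_eval u.2 v.1 + J (dual_eval v.2 u.1) * delta.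

Definition hyperbolic (delta : D) (M : lmodType D^c) (h : M -> M -> D) : Prop :=
  exists (X : vectType D^c) (f : {linear (X * dual J X)%type -> M}),
    bijective f /\ forall u v, h (f u) (f v) = hyperbolic_form delta u v.

Section UnitaryGroup.
Variables (M : lmodType D^c) (h : M -> M -> D).

Definition isometry : {pred M -> M} := fun f =>
  `[< [/\ bijective f, forall u v, f (u + v) = f u + f v,
          forall u a, f (u *> a) = f u *> a & forall u v, h (f u) (f v) = h u v] >].

Definition unitary := {f : M -> M | isometry f}.
HB.instance Definition _ := SubChoice.on unitary.

Lemma isometry1 : isometry idfun.
Proof. by apply/asboolP; split=> //; exists idfun. Qed.

Lemma isometryM f g : isometry f -> isometry g -> isometry (f \o g).
Proof.
move=> /asboolP[f1 f2 f3 f4] /asboolP[g1 g2 g3 g4]; apply/asboolP; split.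
- exact: bij_comp.
- by move=> u v /=; rewrite g2 f2.
- by move=> u a /=; rewrite g3 f3.
- by move=> u v /=; rewrite f4 g4.
Qed.

Lemma isometryV f : isometry f -> exists g, [/\ isometry g, cancel f g & cancel g f].
Proof.
move=> /asboolP[[g fK gK] f2 f3 f4]; exists g; split=> //; apply/asboolP; split.
- by exists f.
- by move=> u v; apply: (can_inj fK); rewrite f2 !gK.
- by move=> u a; apply: (can_inj fK); rewrite f3 !gK.
- by move=> u v; rewrite -f4 !gK.
Qed.

Definition unitary_one : unitary := Sub idfun isometry1.
Definition unitary_mul (f g : unitary) : unitary :=
  Sub (val f \o val g) (isometryM (valP f) (valP g)).

Lemma unitary_inv_ex (f : unitary) :
  {g : unitary | cancel (val f) (val g) & cancel (val g) (val f)}.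
Proof.
case: f => f fi; have [g gP] := cid (isometryV fi).
by case: gP => gi fK gK; exists (Sub g gi).
Qed.
Definition unitary_inv (f : unitary) : unitary := s2val (unitary_inv_ex f).

Lemma unitary_mulA : associative unitary_mul.
Proof. by move=> f g k; apply/val_inj. Qed.
Lemma unitary_mul1 : left_id unitary_one unitary_mul.
Proof. by move=> f; apply/val_inj. Qed.
Lemma unitary_mulr1 : right_id unitary_one unitary_mul.
Proof. by move=> f; apply/val_inj. Qed.
Lemma unitary_mulV : left_inverse unitary_one unitary_inv unitary_mul.
Proof.
move=> f; apply/val_inj/funext => v /=.
by rewrite /unitary_inv; case: unitary_inv_ex => g /= -> .
Qed.
Lemma unitary_mulrV : right_inverse unitary_one unitary_inv unitary_mul.
Proof.
move=> f; apply/val_inj/funext => v /=.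
by rewrite /unitary_inv; case: unitary_inv_ex => g /= _ ->.
Qed.
HB.instance Definition _ := isGroup.Build unitary
  unitary_mulA unitary_mul1 unitary_mulr1 unitary_mulV unitary_mulrV.

Definition eichler (f : M -> M) : Prop :=
  exists u w a, [/\ h u u = 0, h u w = 0, a - J a = h w w &
    forall v, f v = v + w *> h u v + u *> h w v + u *> a *> h u v].

(* Membership in the smallest normal subgroup containing the Eichler
   transformations. *)
Definition in_EU : {pred unitary} := fun f =>
  `[< forall K : set unitary,
        (forall k, eichler (val k) -> K k) ->
        K 1%g -> (forall k l, K k -> K l -> K (k * l)%g) ->
        (forall k, K k -> K (k^-1)%g) ->
        (forall k l, K k -> K (l * k * l^-1)%g) -> K f >].

Lemma in_EU_group_closed : group_closed in_EU.
Proof.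
split=> [|f g /asboolP fE /asboolP gE]; apply/asboolP => K KE K1 KM KV KJ //.
by apply: (KM); [exact: fE | apply: (KV); exact: gE].
Qed.

Definition EU := {f : unitary | in_EU f}.
HB.instance Definition _ := SubChoice.on EU.
HB.instance Definition _ :=
  SubChoice_isSubGroup.Build unitary in_EU EU in_EU_group_closed.
End UnitaryGroup.
End HermitianForms.

Section OppositionGraph.
Variables (D : nzRingType) (M : lmodType D^c) (h : M -> M -> D).

Definition subspace (X : set M) : Prop :=
  [/\ X 0, forall u v, X u -> X v -> X (u + v) & forall u a, X u -> X (u *> a)].

Definition orthogonal (X : set M) : set M := [set v | forall x, X x -> h x v = 0].

Definition is_lagrangian (X : set M) : bool :=
  `[< subspace X /\ X = orthogonal X >].

Definition lagrangian := {X : set M | is_lagrangian X}.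
HB.instance Definition _ := SubChoice.on lagrangian.

Definition opposite (X Y : lagrangian) : Prop := val X `&` val Y = [set 0].

Lemma unitary_can (f : unitary h) v : val f (val (f^-1)%g v) = v.
Proof. exact: (congr1 (fun g : unitary h => val g v) (mulgV f)). Qed.

Lemma unitary_lagrangian (f : unitary h) X :
  is_lagrangian X -> is_lagrangian (val f @` X).
Proof.
move=> /asboolP[[X0 XD XZ] XE].
have /asboolP[_ fD fZ fh] := valP f.
have f0 : val f 0 = 0 by apply: (addIr (val f 0)); rewrite -fD !add0r.
apply/asboolP; split; first split.
- by exists 0.
- by move=> _ _ [u Xu <-] [v Xv <-]; exists (u + v); [exact: XD | rewrite fD].
- by move=> _ a [u Xu <-]; exists (u *> a); [exact: XZ | rewrite fZ].
apply/seteqP; split=> [_ [u Xu <-] _ [x Xx <-]|v Hv].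
  by rewrite fh; move: Xu; rewrite {1}XE; apply.
exists (val (f^-1)%g v); last exact: unitary_can.
rewrite XE => x Xx; rewrite -fh unitary_can; apply: Hv.
by exists x.
Qed.

Definition lagrangian_act (f : unitary h) (X : lagrangian) : lagrangian :=
  Sub (val f @` val X) (unitary_lagrangian f (valP X)).

Lemma lagrangian_act1 X : lagrangian_act 1%g X = X.
Proof. by apply/val_inj; rewrite /= image_id. Qed.

Lemma lagrangian_actM f g X :
  lagrangian_act (f * g)%g X = lagrangian_act f (lagrangian_act g X).
Proof. by apply/val_inj; rewrite /= image_comp. Qed.

Lemma lagrangian_act_opposite f X Y :
  opposite X Y -> opposite (lagrangian_act f X) (lagrangian_act f Y).
Proof.
rewrite /opposite /= => XY.
have /asboolP[/bij_inj fi fD _ _] := valP f.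
have f0 : val f 0 = 0 by apply: (addIr (val f 0)); rewrite -fD !add0r.
apply/seteqP; split=> [_ [[x Xx <-] [y Yy /fi yx]]|_ ->].
  have : (val X `&` val Y) x by split=> //; rewrite -yx.
  by rewrite XY => ->.
have [X0 Y0] : (val X `&` val Y) 0 by rewrite XY.
by split; exists 0.
Qed.

Definition opposition_graph : Ggraph (unitary h) :=
  GGraph lagrangian_act1 lagrangian_actM lagrangian_act_opposite.

Definition lincomb n (x : 'I_n -> M) (c : 'cV[D]_n) : M := \sum_i x i *> c i 0.

Definition basis_of n (x : 'I_n -> M) (X : set M) : Prop :=
  injective (lincomb x) /\ range (lincomb x) = X.

End OppositionGraph.

Section WittGroup.
Variables (D : unitRingType) (J : involution D).

Definition conjmx m n (a : 'M[D]_(m, n)) : 'M[D]_(n, m) := map_mx J a^T.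

(* Over a noncommutative ring [unitmx] is unavailable. *)
Definition mx_inverse m n (a : 'M[D]_(m, n)) (b : 'M[D]_(n, m)) : Prop :=
  a *m b = 1%:M /\ b *m a = 1%:M.

(* A nondegenerate 1-hermitian form on D^n, (x, y) |-> x^J t y. *)
Definition is_form (t : {n : nat & 'M[D]_n}) : bool :=
  `[< conjmx (tagged t) = tagged t /\ exists s, mx_inverse (tagged t) s >].

Definition form := {t : {n : nat & 'M[D]_n} | is_form t}.
HB.instance Definition _ := SubChoice.on form.
Definition dim (t : form) : nat := tag (val t).
Definition fmx (t : form) : 'M[D]_(dim t) := tagged (val t).

(* Rectangular change of bases, so that no identification m = n is needed. *)
Definition isometric m n (s : 'M[D]_m) (t : 'M[D]_n) : Prop :=
  exists (a : 'M[D]_(m, n)) (b : 'M[D]_(n, m)),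
    mx_inverse a b /\ conjmx a *m s *m a = t.

(* Matrix of the 1-hermitian hyperbolic form on X (+) X^J for a basis of X
   followed by its dual basis, dim X = n. *)
Definition hyp_mx n : 'M[D]_(n + n) := block_mx 0 1%:M 1%:M 0.

(* Group completion of the isomorphism classes under orthogonal sum (generators
   <<t>>, relations <<r>> = <<s>> + <<t>> for r isometric to s (+) t), modulo the
   hyperbolic forms. *)
Definition witt_rel : set {freeg form / int} :=
  [set x | exists r s t : form,
     isometric (fmx r) (block_mx (fmx s) 0 0 (fmx t)) /\
     x = << r >> - << s >> - << t >>] `|`
  [set x | exists (r : form) n, isometric (fmx r) (hyp_mx n) /\ x = << r >>].

Definition witt := Quotient.quot (zspan witt_rel).
HB.instance Definition _ := GRing.Zmodule.on witt.

Definition wclass (t : form) : witt :=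
  \pi_(Quotient.quot (zspan witt_rel)) << t >>.

Inductive commutator_prod : D -> Prop :=
| commutator_prod1 : commutator_prod 1
| commutator_prodM a b c :
    a \is a GRing.unit -> b \is a GRing.unit -> commutator_prod c ->
    commutator_prod (a * b * a^-1 * b^-1 * c).

Inductive elementary n : 'M[D]_n -> Prop :=
| elementary1 : elementary 1%:M
| elementaryM i j (a : D) e :
    i != j -> elementary e -> elementary ((1%:M + a *: delta_mx i j) *m e).

(* Dieudonne determinant GL_n(D) -> K_1(D) = D^* / [D^*, D^*], the value being
   a coset of [D^*, D^*] in D^*: t is reduced to a diagonal matrix by elementary
   row operations and det(t) is the class of the product of the diagonal
   entries. *)
Definition dieudonne_det n (t : 'M[D]_n) : set D :=
  [set a | exists (e : 'M[D]_n) (d : 'rV[D]_n) (c : D),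
     [/\ elementary e, forall i, d 0 i \is a GRing.unit, commutator_prod c,
         t = e *m diag_mx d & a = (\prod_i d 0 i) * c]].

Definition II_gen : set witt :=
  [set w | exists t : form, [/\ (4 %| dim t)%N, dieudonne_det (fmx t) 1 & w = wclass t]].

Definition II := zspan_sub II_gen.
HB.instance Definition _ := GRing.Zmodule.on II.
Definition II_incl : {additive II -> witt} := val.
End WittGroup.

Section Maslov.
Variables (D : unitRingType) (J : involution D).
Variables (M : lmodType D^c) (h : M -> M -> D).

(* kappa(X, Y, Z) is the isomorphism class of all such t. *)
Definition kappa (X Y Z : lagrangian h) (t : form J) : Prop :=
  exists x y : 'I_(dim t) -> M,
    [/\ basis_of x (val X), basis_of y (val Y),
        forall mu nu, h (y mu) (x nu) = (mu == nu)%:R &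
        basis_of (fun nu => y nu + \sum_mu x mu *> fmx t mu nu) (val Z)].

(* The class does not depend on t.  No t exists when X, Y, Z are not pairwise
   opposite; the value is then 0, in accordance with alternating chains for
   triples with coincidences. *)
Definition maslov (X Y Z : lagrangian h) : witt J :=
  xget 0 [set w | exists t, [/\ opposite X Y, opposite Y Z, opposite X Z,
                                kappa X Y Z t & w = wclass t]].

(* p (x) z |-> eta(p) m(z) on P_0 (x)_G C_2, and zero on P_1 (x)_G C_1 and
   P_2 (x)_G C_0. *)
Definition maslov_cochain : eqcomplex (opposition_graph h) (witt J) :=
  fun s v => match s, v with
             | [:: _], [:: X; Y; Z] => maslov X Y Z
             | _, _ => 0
             end.

(* The preimage of the class of maslov_cochain under the isomorphism
   H^2(U(M); W) -> H^2_U(M)(Fl; W); the default value 0 of xget is irrelevant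
   when D^1 is infinite. *)
Definition maslov_class : gcohomology (unitary h) (witt J) 2 :=
  xget 0 [set c | exists z : cocycles (eqcomplex (opposition_graph h) (witt J)) 2,
                    val z = maslov_cochain /\ aug_hom _ c = cclass z].

Definition EU_incl : {multiplicative EU J h -> unitary h} := val.
End Maslov.

(* Main.v *)
Require Import Defs.
From HB Require Import structures.
From mathcomp Require Import all_boot all_order all_algebra.
From mathcomp Require Import all_classical.
(* conjmx and basis_of also name notions of matrix and vector space theory. *)
Import Defs.

(** Let W = W^1(D, J). Uniqueness and existence are both settled in W/II.

   EU(M) is perfect ([EU_perfect]). Conjugating a transvection with parameter x by
   a dilation in EU(M) changes x into c x c, where x and c are in D^1, and since
   D^1 is infinite an additive map that is invariant under all these substitutions
   is zero ([jordan_invariant_eq0]). The obstruction to uniqueness of the lift is a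
   homomorphism from EU(M) to W/II, so the lift is unique ([coef_hom_inj]).

   For existence, the Maslov class has to vanish with coefficients in W/II. There
   the class of a hermitian form t depends only on its dimension n and on its
   determinant in K_1(D): if t and t' agree in both, then t + (-t'^-1), padded by
   hyperbolic planes, has dimension divisible by 4 and determinant 1
   ([disc_uniq]). Hence [t] = n[1] + F(det t), where F ([det_disc]) is a
   homomorphism on the subgroup Sigma of K_1(D) of all determinants of hermitian
   forms ([form_dets]).

   For bases x, y, z of pairwise opposite Lagrangians, kappa is the class of
   (h(x,y)^J)^-1 h(y,z) h(x,z)^-1, where h(x,y) stands for the Gram matrix. With
   s(x,y) = det h(x,y), its determinant is s(x,y) + s(y,z) - s(x,z) up to a norm, and
   F kills norms ([disc_maslov]). Consider now only the bases in the EU(M)-orbit of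
   one basis of one Lagrangian. On this orbit s is an EU(M)-invariant cocycle with
   values in K_1(D)/Sigma, hence the coboundary of a potential; by invariance the
   potential is a homomorphism on EU(M) up to a constant, so that it is constant
   and s has values in Sigma ([orbit_det_form_dets]). Therefore
   r(x,y) = n[1] + F(s(x,y)) is defined, EU(M)-invariant, and its coboundary is the
   Maslov cocycle modulo II ([maslov_mod_II_coboundary]). The passage from the
   opposition graph to the group is [transgression].

   Potentials exist because finitely many Lagrangians always have a common opposite
   in a given EU(M)-orbit ([common_opposite], [edge_cocycle_coboundary]): a
   transvection along u with general parameter moves a Lagrangian off finitely many
   others except along their parts orthogonal to u, and isotropic vectors u
   span M. *)

Set Implicit Arguments.
Unset Strict Implicit.
Unset Printing Implicit Defensive.

Import GRing.Theory.
Local Open Scope ring_scope.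
Local Open Scope quotient_scope.
Local Open Scope classical_set_scope.

(** * The group K_1(D) *)

Section Abelianization.
Variable D : unitRingType.
Implicit Types a b c g : D.

Lemma unitMr a b : a \is a GRing.unit -> b \is a GRing.unit ->
  a * b \is a GRing.unit.
Proof. by move=> ua ub; rewrite unitrMl. Qed.

Lemma unitVr a : a \is a GRing.unit -> a^-1 \is a GRing.unit.
Proof. by rewrite unitrV. Qed.

#[local] Hint Resolve unitMr unitVr : core.

Lemma commutator_prod_unit c : commutator_prod c -> c \is a GRing.unit.
Proof.
by elim=> [|a b {}c ua ub _ uc]; [exact: unitr1 | do 4?apply: unitMr; auto].
Qed.

Lemma commutator_prod_comm a b : a \is a GRing.unit -> b \is a GRing.unit ->
  commutator_prod (a * b * a^-1 * b^-1).
Proof.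
move=> ua ub; rewrite -[X in commutator_prod X]mulr1.
by apply: commutator_prodM => //; exact: commutator_prod1.
Qed.

Lemma commutator_prodMM c c' :
  commutator_prod c -> commutator_prod c' -> commutator_prod (c * c').
Proof.
move=> cc cc'; elim: cc => [|a b {}c ua ub _ IH]; first by rewrite mul1r.
by rewrite -mulrA; apply: commutator_prodM.
Qed.

Lemma commutator_prodV c : commutator_prod c -> commutator_prod c^-1.
Proof.
elim=> [|a b {}c ua ub cc IH]; first by rewrite invr1; exact: commutator_prod1.
have uc := commutator_prod_unit cc.
have -> : (a * b * a^-1 * b^-1 * c)^-1 = c^-1 * (b * a * b^-1 * a^-1).
  by rewrite !invrM ?invrK ?mulrA //; auto 6.
apply: commutator_prodMM => //.
exact: commutator_prod_comm.
Qed.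

(** g^-1 c g is c times the commutator of c^-1 and g^-1. *)
Lemma commutator_prodJ c g : g \is a GRing.unit ->
  commutator_prod c -> commutator_prod (g^-1 * c * g).
Proof.
move=> ug cc; have uc := commutator_prod_unit cc.
have -> : g^-1 * c * g = c * (c^-1 * g^-1 * c^-1^-1 * g^-1^-1).
  by rewrite !invrK !mulrA mulrV // mul1r.
by apply: commutator_prodMM => //; apply: commutator_prod_comm; auto.
Qed.

Definition units := {a : D | a \is a GRing.unit}.
HB.instance Definition _ := SubChoice.on units.
Definition Unit a (ua : a \is a GRing.unit) : units := exist _ a ua.
Definition unit_one : units := Unit (unitr1 D).
Definition unit_mul (a b : units) : units := Unit (unitMr (valP a) (valP b)).
Definition unit_inv (a : units) : units := Unit (unitVr (valP a)).

Definition commutator_equiv : rel units :=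
  fun x y => `[< commutator_prod ((val y)^-1 * val x) >].

Lemma commutator_equiv_refl : reflexive commutator_equiv.
Proof.
by case=> a ua; apply/asboolP; rewrite /= mulVr //; exact: commutator_prod1.
Qed.

Lemma commutator_equiv_sym : symmetric commutator_equiv.
Proof.
suff S x y : commutator_equiv x y -> commutator_equiv y x.
  by move=> x y; apply/idP/idP; exact: S.
case: x y => [a ua] [b ub] /asboolP /commutator_prodV /=.
by rewrite invrM ?invrK //; auto => ?; apply/asboolP.
Qed.

Lemma commutator_equiv_trans : transitive commutator_equiv.
Proof.
case=> [b ub] [a ua] [c uc] /asboolP /= cab /asboolP /= cbc; apply/asboolP.
by rewrite /= -(mulVKr ub a) mulrA; exact: commutator_prodMM.
Qed.

Canonical commutator_equiv_rel := EquivRel commutator_equiv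
  commutator_equiv_refl commutator_equiv_sym commutator_equiv_trans.

(** K_1(D), written additively so that it and its quotients can be the values
   of cochains. *)
Definition K1 := {eq_quot commutator_equiv}%qT.
HB.instance Definition _ := Choice.on K1.

Definition K1_of (a : units) : K1 := \pi_K1 a.

Lemma K1_ofP (a b : units) : K1_of a = K1_of b <-> commutator_prod ((val b)^-1 * val a).
Proof.
split=> [/eqmodP/asboolP //|cab].
by apply/eqmodP/asboolP.
Qed.

Lemma K1_ofM (a a' b b' : units) : K1_of a = K1_of a' -> K1_of b = K1_of b' ->
  K1_of (unit_mul a b) = K1_of (unit_mul a' b').
Proof.
move=> /K1_ofP ca /K1_ofP cb; apply/K1_ofP => /=.
have [ub ub'] := (valP b, valP b'); have ua' := valP a'.
rewrite invrM // -mulrA (mulrA _ (val a)) -(mulVKr ub' (val b)) !mulrA.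
rewrite -(mulrA _ _ (val b)); apply: commutator_prodMM => //.
by rewrite -(mulrA (val b')^-1); exact: commutator_prodJ.
Qed.

Definition K1_zero : K1 := K1_of unit_one.
Definition K1_opp (x : K1) : K1 := K1_of (unit_inv (repr x)).
Definition K1_add (x y : K1) : K1 := K1_of (unit_mul (repr x) (repr y)).

Lemma K1_of_repr x : K1_of (repr x) = x.
Proof. exact: reprK. Qed.

Lemma K1_of_mul (a b : units) : K1_add (K1_of a) (K1_of b) = K1_of (unit_mul a b).
Proof. by apply: K1_ofM; rewrite K1_of_repr. Qed.

Lemma K1_addA : associative K1_add.
Proof.
move=> x y z; rewrite -(K1_of_repr x) -(K1_of_repr y) -(K1_of_repr z).
by rewrite !K1_of_mul; congr K1_of; apply: val_inj; rewrite /= mulrA.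
Qed.

Lemma K1_addC : commutative K1_add.
Proof.
move=> x y; rewrite -(K1_of_repr x) -(K1_of_repr y) !K1_of_mul.
case: (repr x) (repr y) => [a ua] [b ub]; apply/K1_ofP => /=.
rewrite invrM // !mulrA -{2}(invrK a) -{2}(invrK b).
by apply: commutator_prod_comm; auto.
Qed.

Lemma K1_add0 : left_id K1_zero K1_add.
Proof.
move=> x; rewrite -(K1_of_repr x) K1_of_mul; congr K1_of.
by apply: val_inj; rewrite /= mul1r.
Qed.

Lemma K1_addN : left_inverse K1_zero K1_opp K1_add.
Proof.
move=> x; rewrite -{2}(K1_of_repr x) K1_of_mul; congr K1_of.
by apply: val_inj; rewrite /= mulVr // (valP (repr x)).
Qed.

HB.instance Definition _ :=
  GRing.isZmodule.Build K1 K1_addA K1_addC K1_add0 K1_addN.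

(** Non-units are sent to 0. *)
Definition k1 (a : D) : K1 := K1_of (insubd unit_one a).

Lemma k1M a b : a \is a GRing.unit -> b \is a GRing.unit ->
  k1 (a * b) = k1 a + k1 b.
Proof.
move=> ua ub; rewrite [RHS]K1_of_mul; congr K1_of; apply: val_inj.
have ue c : c \is a GRing.unit -> val (insubd unit_one c) = c.
  by move=> uc; rewrite insubdK.
by rewrite ue ?unitMr // -[RHS]/(val _ * val _) !ue.
Qed.

Lemma k1_1 : k1 1 = 0.
Proof.
suff e : insubd unit_one 1 = unit_one by rewrite /k1 e.
by apply: val_inj; rewrite insubdK ?unitr1.
Qed.

Lemma k1V a : a \is a GRing.unit -> k1 a^-1 = - k1 a.
Proof.
by move=> ua; apply: (addrI (k1 a)); rewrite -k1M ?unitrV // mulrV // k1_1 subrr.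
Qed.

(** The only place where a relation in K_1(D) is turned back into a product of
   commutators, as the generators of II require. *)
Lemma k1_eq0 a : a \is a GRing.unit -> k1 a = 0 -> commutator_prod a.
Proof.
by move=> ua /K1_ofP; rewrite insubdK // invr1 mul1r.
Qed.

Lemma k1_prod n (d : 'I_n -> D) : (forall i, d i \is a GRing.unit) ->
  \prod_i d i \is a GRing.unit /\ k1 (\prod_i d i) = \sum_i k1 (d i).
Proof.
move=> ud; elim/big_rec2: _ => [|i x y _ [uy <-]].
  by rewrite k1_1; split=> //; exact: unitr1.
by rewrite k1M // unitMr.
Qed.

Lemma k1N1 : k1 (-1) + k1 (-1) = 0.
Proof. by rewrite -k1M ?unitrN1 // mulrNN mul1r k1_1. Qed.
End Abelianization.

(** * Elementary matrices *)

Section Elementary.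
Variable D : unitRingType.

Lemma elementary_gen n (i j : 'I_n) (a : D) :
  i != j -> elementary (1%:M + a *: delta_mx i j).
Proof.
move=> ij; rewrite -[X in elementary X]mulmx1.
by apply: elementaryM => //; exact: elementary1.
Qed.

Lemma elementary_mul n (e f : 'M[D]_n) :
  elementary e -> elementary f -> elementary (e *m f).
Proof.
move=> he hf; elim: he => [|i j a {}e ij _ IH]; first by rewrite mul1mx.
by rewrite -mulmxA; apply: elementaryM.
Qed.

Lemma scale_delta_mul n (a b : D) (i j k l : 'I_n) :
  (a *: delta_mx i j) *m (b *: delta_mx k l) =
  if j == k then (a * b) *: delta_mx i l else 0.
Proof.
apply/matrixP => p q; rewrite !mxE (bigD1 j) //= big1 ?addr0 => [|r rj]; last first.
  by rewrite !mxE (negPf rj) andbF mulr0 mul0r.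
rewrite !mxE eqxx andbT; case: (j == k); rewrite !mxE /= ?mulr0 //.
by case: (p == i); case: (q == l); rewrite /= ?(mulr0, mulr1, mul0r).
Qed.

Lemma elementary_inv n (e : 'M[D]_n) : elementary e ->
  exists2 f, elementary f & mx_inverse e f.
Proof.
elim=> [|i j a {}e ij _ [f hf [ef fe]]].
  by exists 1%:M; [exact: elementary1 | split; rewrite mul1mx].
have tt (b : D) : (1%:M + b *: delta_mx i j) *m (1%:M + (- b) *: delta_mx i j)
     = 1%:M.
  rewrite mulmxDl mul1mx mulmxDr mulmx1 scale_delta_mul eq_sym (negPf ij) addr0.
  by rewrite scaleNr addrNK.
exists (f *m (1%:M + (- a) *: delta_mx i j)).
  by apply: elementary_mul => //; exact: elementary_gen.
split.
  by rewrite mulmxA -(mulmxA _ e) ef mulmx1 tt.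
by rewrite mulmxA -(mulmxA f) -{2}[a]opprK tt mulmx1.
Qed.

(** Diagonal matrices normalize the elementary group; this makes [has_det]
   multiplicative. *)
Lemma diag_elementary n (d : 'rV[D]_n) (e : 'M[D]_n) :
  (forall i, d 0 i \is a GRing.unit) -> elementary e ->
  exists2 f, elementary f & diag_mx d *m e = f *m diag_mx d.
Proof.
move=> ud; elim=> [|i j a {}e ij _ [f hf ef]].
  by exists 1%:M; [exact: elementary1 | rewrite mulmx1 mul1mx].
exists ((1%:M + (d 0 i * a * (d 0 j)^-1) *: delta_mx i j) *m f).
  by apply: elementaryM.
rewrite -[RHS]mulmxA -ef !mulmxA; congr (_ *m _).
rewrite mulmxDr mulmx1 mulmxDl mul1mx; congr (_ + _).
apply/matrixP => p q; rewrite mul_diag_mx mul_mx_diag !mxE.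
have [->|_] := eqVneq p i; rewrite /= ?(mulr0, mul0r) //.
have [->|_] := eqVneq q j; rewrite /= ?(mulr0, mul0r) //.
by rewrite !mulr1 divrK.
Qed.

Section Blocks.
Variables m n : nat.

Lemma block_one_gen_upper (i : 'I_m) (j : 'I_n) (a : D) :
  block_mx 1%:M (a *: delta_mx i j) 0 1%:M =
  1%:M + a *: delta_mx (lshift n i) (rshift m j) :> 'M_(m + n).
Proof.
rewrite -[RHS]submxK; congr block_mx; apply/matrixP => p q; rewrite !mxE /=.
- by rewrite eq_lrshift andbF mulr0 addr0 (inj_eq (@lshift_inj _ _)).
- by rewrite eq_lrshift add0r (inj_eq (@lshift_inj _ _)) (inj_eq (@rshift_inj _ _)).
- by rewrite !eq_rlshift !eq_lrshift andbF mulr0 addr0.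
- by rewrite !eq_rlshift mulr0 addr0 (inj_eq (@rshift_inj _ _)).
Qed.

Lemma block_one_gen_lower (i : 'I_m) (j : 'I_n) (a : D) :
  block_mx 1%:M 0 (a *: delta_mx j i) 1%:M =
  1%:M + a *: delta_mx (rshift m j) (lshift n i) :> 'M_(m + n).
Proof.
rewrite -[RHS]submxK; congr block_mx; apply/matrixP => p q; rewrite !mxE /=.
- by rewrite !eq_lrshift mulr0 addr0 (inj_eq (@lshift_inj _ _)).
- by rewrite !eq_lrshift mulr0 addr0.
- by rewrite eq_rlshift add0r (inj_eq (@lshift_inj _ _)) (inj_eq (@rshift_inj _ _)).
- by rewrite !eq_rlshift andbF mulr0 addr0 (inj_eq (@rshift_inj _ _)).
Qed.

(** B |-> block_mx 1 B 0 1 turns sums into products, so that it suffices to treat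
   one entry at a time. *)
Lemma mx_scale_delta_ind p q (P : 'M[D]_(p, q) -> Prop) :
  P 0 -> (forall A B, P A -> P B -> P (A + B)) ->
  (forall i j a, P (a *: delta_mx i j)) -> forall A, P A.
Proof.
move=> P0 PD Pg A; rewrite (matrix_sum_delta A).
by elim/big_ind: _ => // i _; elim/big_ind: _ => // j _.
Qed.

Lemma elementary_upper (B : 'M[D]_(m, n)) :
  elementary (block_mx 1%:M B 0 1%:M).
Proof.
elim/mx_scale_delta_ind: B => [|A B hA hB|i j a].
- by rewrite -scalar_mx_block; exact: elementary1.
- rewrite (_ : block_mx _ _ _ _ = block_mx 1%:M B 0 1%:M *m block_mx 1%:M A 0 1%:M).
    exact: elementary_mul.
  by rewrite mulmx_block !mulmx1 !mul1mx !mulmx0 !mul0mx !addr0 add0r.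
- by rewrite block_one_gen_upper; apply: elementary_gen; rewrite eq_lrshift.
Qed.

Lemma elementary_lower (B : 'M[D]_(n, m)) :
  elementary (block_mx 1%:M 0 B 1%:M).
Proof.
elim/mx_scale_delta_ind: B => [|A B hA hB|i j a].
- by rewrite -scalar_mx_block; exact: elementary1.
- rewrite (_ : block_mx _ _ _ _ = block_mx 1%:M 0 A 1%:M *m block_mx 1%:M 0 B 1%:M).
    exact: elementary_mul.
  by rewrite mulmx_block !mulmx1 !mul1mx !mulmx0 !mul0mx !addr0 add0r.
- by rewrite block_one_gen_lower; apply: elementary_gen; rewrite eq_rlshift.
Qed.

Lemma elementary_block (e : 'M[D]_m) (f : 'M[D]_n) :
  elementary e -> elementary f -> elementary (block_mx e 0 0 f).
Proof.
move=> he hf.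
have -> : block_mx e 0 0 f = block_mx e 0 0 1%:M *m block_mx 1%:M 0 0 f.
  by rewrite mulmx_block !mulmx1 !mul1mx !mulmx0 !mul0mx !addr0 add0r.
apply: elementary_mul.
  elim: he => [|i j a {}e ij _ IH].
    by rewrite -scalar_mx_block; exact: elementary1.
  rewrite (_ : block_mx _ _ _ _ =
    block_mx (1%:M + a *: delta_mx i j) 0 0 1%:M *m block_mx e 0 0 1%:M).
    apply: elementary_mul => //.
    rewrite (_ : block_mx _ _ _ _ = 1%:M + a *: delta_mx (lshift n i) (lshift n j)).
      by apply: elementary_gen; rewrite (inj_eq (@lshift_inj _ _)).
    rewrite -[RHS]submxK; congr block_mx; apply/matrixP => p q; rewrite !mxE /=.
    - by rewrite !(inj_eq (@lshift_inj _ _)).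
    - by rewrite !eq_lrshift !eq_rlshift andbF mulr0 addr0.
    - by rewrite !eq_rlshift mulr0 addr0.
    - by rewrite !eq_rlshift mulr0 addr0 (inj_eq (@rshift_inj _ _)).
  by rewrite mulmx_block !mulmx1 ?mul1mx !mulmx0 !mul0mx !addr0 add0r.
elim: hf => [|i j a {}f ij _ IH].
  by rewrite -scalar_mx_block; exact: elementary1.
rewrite (_ : block_mx _ _ _ _ =
    block_mx 1%:M 0 0 (1%:M + a *: delta_mx i j) *m block_mx 1%:M 0 0 f).
  apply: elementary_mul => //.
  rewrite (_ : block_mx _ _ _ _ = 1%:M + a *: delta_mx (rshift m i) (rshift m j)).
    by apply: elementary_gen; rewrite (inj_eq (@rshift_inj _ _)).
  rewrite -[RHS]submxK; congr block_mx; apply/matrixP => p q; rewrite !mxE /=.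
  - by rewrite !eq_lrshift mulr0 addr0 (inj_eq (@lshift_inj _ _)).
  - by rewrite !eq_lrshift mulr0 addr0.
  - by rewrite !eq_rlshift !eq_lrshift andbF mulr0 addr0.
  - by rewrite !(inj_eq (@rshift_inj _ _)).
by rewrite mulmx_block !mulmx1 ?mul1mx !mulmx0 !mul0mx !addr0 !add0r.
Qed.
End Blocks.
End Elementary.

(** * Determinants over a division ring *)

Section Determinant.
Variable D : unitRingType.

Lemma mx_inverse_uniq m n (a : 'M[D]_(m, n)) b b' :
  mx_inverse a b -> mx_inverse a b' -> b = b'.
Proof.
by move=> [_ ba] [ab' _]; rewrite -[b]mulmx1 -ab' mulmxA ba mul1mx.
Qed.

Lemma mx_inverse_sym m n (a : 'M[D]_(m, n)) b : mx_inverse a b -> mx_inverse b a.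
Proof. by case. Qed.

Lemma mx_inverseM m n p (a : 'M[D]_(m, n)) (b : 'M[D]_(n, p)) a' b' :
  mx_inverse a a' -> mx_inverse b b' -> mx_inverse (a *m b) (b' *m a').
Proof.
move=> [aa' a'a] [bb' b'b]; split.
  by rewrite mulmxA -(mulmxA a) bb' mulmx1.
by rewrite mulmxA -(mulmxA b') a'a mulmx1.
Qed.

Lemma mx_inverseN n (a a' : 'M[D]_n) : mx_inverse a a' -> mx_inverse (- a) (- a').
Proof. by move=> [aa' a'a]; split; rewrite mulmxN mulNmx opprK. Qed.

(** One value of the Dieudonne determinant, as a relation. The values for a given
   matrix differ by values for the identity matrix; these are harmless below
   because they are determinants of hermitian forms on which [det_disc]
   vanishes. *)
Definition has_det n (A : 'M[D]_n) (x : K1 D) : Prop :=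
  exists (e : 'M[D]_n) (d : 'rV[D]_n),
    [/\ elementary e, forall i, d 0 i \is a GRing.unit, A = e *m diag_mx d
      & x = \sum_i k1 (d 0 i)].

Lemma has_det_diag n (d : 'rV[D]_n) : (forall i, d 0 i \is a GRing.unit) ->
  has_det (diag_mx d) (\sum_i k1 (d 0 i)).
Proof.
by move=> ud; exists 1%:M, d; split; rewrite ?mul1mx //; exact: elementary1.
Qed.

Lemma has_det_elementary n (e : 'M[D]_n) : elementary e -> has_det e 0.
Proof.
move=> he; exists e, (const_mx 1); split=> //.
- by move=> i; rewrite mxE unitr1.
- by rewrite diag_const_mx mulmx1.
- by rewrite big1 // => i _; rewrite mxE k1_1.
Qed.

Lemma has_det1 n : has_det (1%:M : 'M[D]_n) 0.
Proof. exact/has_det_elementary/elementary1. Qed.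

Lemma has_detN1 n : has_det (- 1%:M : 'M[D]_n) (k1 (-1) *+ n).
Proof.
have -> : - 1%:M = diag_mx (const_mx (- 1)) :> 'M[D]_n.
  by rewrite diag_const_mx raddfN.
have -> : k1 (-1) *+ n = \sum_i k1 ((const_mx (-1) : 'rV[D]_n) 0 i).
  by under eq_bigr do rewrite mxE; rewrite sumr_const card_ord.
by apply: has_det_diag => i; rewrite mxE unitrN1.
Qed.

Lemma has_detM n (A B : 'M[D]_n) x y :
  has_det A x -> has_det B y -> has_det (A *m B) (x + y).
Proof.
move=> [e [d [he ud -> ->]]] [f [c [hf uc -> ->]]].
have [g hg dfg] := diag_elementary ud hf.
exists (e *m g), (\row_i (d 0 i * c 0 i)); split.
- exact: elementary_mul.
- by move=> i; rewrite mxE unitMr.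
- rewrite mulmxA -(mulmxA e) dfg -!mulmxA; do 2!congr (_ *m _).
  by rewrite mulmx_diag.
- by rewrite -big_split; apply: eq_bigr => i _; rewrite mxE k1M.
Qed.

Lemma has_det_inv n (A B : 'M[D]_n) x :
  mx_inverse A B -> has_det A x -> has_det B (- x).
Proof.
move=> AB [e [d [he ud eA ->]]].
have [f hf ef] := elementary_inv he.
pose d' : 'rV[D]_n := \row_i (d 0 i)^-1.
have dd' : mx_inverse (diag_mx d) (diag_mx d').
  split; rewrite mulmx_diag -diag_const_mx; congr diag_mx; apply/rowP => i.
    by rewrite !mxE mulrV.
  by rewrite !mxE mulVr.
have -> : B = diag_mx d' *m f.
  by apply: (mx_inverse_uniq AB); rewrite eA; exact: mx_inverseM.
rewrite -[- _]addr0; apply: has_detM; last exact: has_det_elementary.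
rewrite -sumrN (eq_bigr (fun i => k1 (d' 0 i))) => [|i _]; last by rewrite mxE k1V.
by apply: has_det_diag => i; rewrite mxE unitVr.
Qed.

Lemma has_detN n (A : 'M[D]_n) x : has_det A x -> has_det (- A) (k1 (-1) *+ n + x).
Proof.
by move=> hA; rewrite -[A]mul1mx -mulNmx; apply: has_detM => //; exact: has_detN1.
Qed.

Lemma has_det_block m n (A : 'M[D]_m) (B : 'M[D]_n) x y :
  has_det A x -> has_det B y -> has_det (block_mx A 0 0 B) (x + y).
Proof.
move=> [e [d [he ud -> ->]]] [f [c [hf uc -> ->]]].
exists (block_mx e 0 0 f), (row_mx d c); split.
- exact: elementary_block.
- by move=> i; rewrite mxE; case: splitP.
- by rewrite diag_mx_row mulmx_block !mulmx0 !mul0mx !addr0 !add0r.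
- rewrite big_split_ord; congr (_ + _); apply: eq_bigr => i _.
    by rewrite row_mxEl.
  by rewrite row_mxEr.
Qed.

Lemma has_det_invertible n (A : 'M[D]_n) x :
  has_det A x -> exists B, mx_inverse A B.
Proof.
move=> [e [d [he ud -> _]]].
have [f hf ef] := elementary_inv he.
exists (diag_mx (\row_i (d 0 i)^-1) *m f); apply: mx_inverseM => //.
split; rewrite mulmx_diag -diag_const_mx; congr diag_mx; apply/rowP => i.
  by rewrite !mxE mulrV.
by rewrite !mxE mulVr.
Qed.

(** The link with the generators of II. *)
Lemma has_det0_dieudonne n (A : 'M[D]_n) : has_det A 0 -> dieudonne_det A 1.
Proof.
move=> [e [d [he ud -> d0]]].
have [up pE] := k1_prod ud.
exists e, d, (\prod_i d 0 i)^-1; split=> //; last by rewrite mulrV.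
by apply/commutator_prodV/k1_eq0 => //; rewrite pE.
Qed.

Hypothesis D_division : forall a : D, a != 0 -> a \is a GRing.unit.

(** Gaussian elimination over a division ring. *)
Lemma has_det_or_kernel n (A : 'M[D]_n) :
  (exists x, has_det A x) \/ (exists2 c : 'cV[D]_n, c != 0 & A *m c = 0).
Proof.
elim: n A => [|n IH] A.
  by left; exists 0; rewrite (_ : A = 1%:M); 
    [exact: has_det1 | by apply/matrixP => -[]].
rewrite -[n.+1]/(1 + n)%N in A *.
have [A0|] := eqVneq (lsubmx A) 0.
  right; exists (col_mx 1 0).
    apply/eqP => /(congr1 usubmx); rewrite col_mxKu linear0 => /matrixP/(_ 0 0).
    by rewrite !mxE => /eqP; rewrite oner_eq0.
  by rewrite -[A]hsubmxK A0 mul_row_col mul0mx mulmx0 addr0.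
(* The Schur complement S reduces the case of a nonzero corner u to size n. *)
have corner (B : 'M[D]_(1 + n)) (u : D) : ulsubmx B = u%:M -> u != 0 ->
    (exists x, has_det B x) \/ (exists2 c : 'cV[D]_(1 + n), c != 0 & B *m c = 0).
  move=> Bu /D_division uu; pose v := (u^-1)%:M : 'M[D]_1.
  pose S := drsubmx B - dlsubmx B *m v *m ursubmx B.
  have uv : u%:M *m v = 1%:M by rewrite -scalar_mxM mulrV.
  have vu : v *m u%:M = 1%:M by rewrite -scalar_mxM mulVr.
  have BE : B = block_mx 1%:M 0 (dlsubmx B *m v) 1%:M *m block_mx u%:M 0 0 S
                *m block_mx 1%:M (v *m ursubmx B) 0 1%:M.
    rewrite !mulmx_block !mulmx1 !mul1mx !mulmx0 !mul0mx !addr0 !add0r.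
    rewrite -(mulmxA _ v) vu mulmx1 !(mulmxA _ v) uv mul1mx addrC subrK.
    by rewrite -Bu submxK.
  case: (IH S) => [[x hS]|[c c0 Sc]].
    left; exists (0 + (k1 u + x) + 0); rewrite BE; apply: has_detM.
      apply: has_detM; first exact/has_det_elementary/elementary_lower.
      apply: has_det_block => //.
      have -> : k1 u = \sum_(i < 1) k1 ((const_mx u : 'rV[D]_1) 0 i).
        by rewrite big_ord1 mxE.
      by rewrite -diag_const_mx; apply: has_det_diag => i; rewrite mxE.
    exact/has_det_elementary/elementary_upper.
  move: (v *m ursubmx B) BE => r BE; right; exists (col_mx (- (r *m c)) c).
    by apply: contra c0 => /eqP/(congr1 dsubmx); rewrite col_mxKd linear0 => ->.
  rewrite BE -!mulmxA (mul_block_col 1%:M) !mul1mx mul0mx add0r addNr.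
  by rewrite mul_block_col !mulmx0 mul0mx Sc !addr0 col_mx0 mulmx0.
have [A00|A00] := eqVneq (A 0 0) 0; last first.
  move=> _; apply: (corner A (A 0 0)) => //.
  by apply/matrixP => i j; rewrite !ord1 !mxE /= mulr1n; congr (A _ _); apply: val_inj.
move=> /eqP A0.
have [i Ai0] : exists i, A i 0 != 0.
  apply: contra_notP A0 => nA; apply/matrixP => i j; rewrite !ord1 !mxE.
  rewrite (_ : lshift n 0 = 0); last exact: val_inj.
  by apply/eqP; apply: contrapT => /negP ne; apply: nA; exists i.
have i0 : 0 != i by apply: contraNneq Ai0 => <-; rewrite A00.
(* Adding row i to row 0 makes the corner nonzero. *)
pose e : 'M[D]_(1 + n) := 1%:M + 1 *: delta_mx 0 i.
have he : elementary e by exact: elementary_gen.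
have [f hf [ef fe]] := elementary_inv he.
have eA : (e *m A) 0 0 = A i 0.
  rewrite mulmxDl mul1mx scale1r !mxE A00 add0r (bigD1 i) //= big1 => [|j ji].
    by rewrite !mxE !eqxx mul1r addr0.
  by rewrite mxE (negPf ji) andbF mul0r.
case: (corner (e *m A) (A i 0)) => //.
- apply/matrixP => j k; rewrite !ord1 mxE mxE [RHS]mxE /= mulr1n.
  by rewrite -eA; congr (_ _ _); apply: val_inj.
- move=> [x hx]; left; exists (0 + x); rewrite -[A]mul1mx -fe -mulmxA.
  by apply: has_detM => //; exact: has_det_elementary.
- move=> [c c0 eAc]; right; exists c => //.
  by rewrite -[A]mul1mx -fe -!mulmxA (mulmxA e) eAc mulmx0.
Qed.

Lemma has_det_ex n (A B : 'M[D]_n) : mx_inverse A B -> exists x, has_det A x.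
Proof.
move=> [_ BA]; case: (has_det_or_kernel A) => // -[c /eqP c0 Ac]; case: c0.
by rewrite -[c]mul1mx -BA -mulmxA Ac mulmx0.
Qed.
End Determinant.

(** * Hermitian forms and their Witt classes *)

Section Forms.
Variables (D : unitRingType) (J : involution D).

Lemma invo0 : J 0 = 0.
Proof. by apply: (addIr (J 0)); rewrite -invoD !add0r. Qed.

Lemma invoN a : J (- a) = - J a.
Proof. by apply: (addIr (J a)); rewrite -invoD !addNr invo0. Qed.

Lemma invo_sum I r (P : pred I) (f : I -> D) :
  J (\sum_(i <- r | P i) f i) = \sum_(i <- r | P i) J (f i).
Proof. exact: (big_morph J (invoD J) invo0). Qed.

Lemma invo_unit a : a \is a GRing.unit -> J a \is a GRing.unit.
Proof.
move=> ua; apply/unitrP; exists (J a^-1).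
by rewrite -!invoM mulrV // mulVr // invo1.
Qed.

Lemma invoV a : a \is a GRing.unit -> J a^-1 = (J a)^-1.
Proof.
move=> ua; apply: (mulrI (invo_unit ua)).
by rewrite -invoM mulVr // invo1 mulrV // invo_unit.
Qed.

Lemma conjmxE m n (a : 'M[D]_(m, n)) i j : conjmx J a i j = J (a j i).
Proof. by rewrite !mxE. Qed.

Lemma conjmxM m n p (a : 'M[D]_(m, n)) (b : 'M[D]_(n, p)) :
  conjmx J (a *m b) = conjmx J b *m conjmx J a.
Proof.
apply/matrixP => i j; rewrite conjmxE mxE [RHS]mxE invo_sum; apply: eq_bigr => k _.
by rewrite invoM !conjmxE.
Qed.

Lemma conjmxK m n (a : 'M[D]_(m, n)) : conjmx J (conjmx J a) = a.
Proof. by apply/matrixP => i j; rewrite !conjmxE invoK. Qed.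

Lemma conjmx1 n : conjmx J (1%:M : 'M[D]_n) = 1%:M.
Proof.
apply/matrixP => i j; rewrite conjmxE !mxE eq_sym.
by case: eqP => _; rewrite ?invo1 ?invo0.
Qed.

Lemma conjmx0 m n : conjmx J (0 : 'M[D]_(m, n)) = 0.
Proof. by apply/matrixP => i j; rewrite conjmxE !mxE invo0. Qed.

Lemma conjmxN m n (a : 'M[D]_(m, n)) : conjmx J (- a) = - conjmx J a.
Proof. by apply/matrixP => i j; rewrite !(conjmxE, mxE) invoN. Qed.

Lemma conjmx_diag n (d : 'rV[D]_n) : conjmx J (diag_mx d) = diag_mx (map_mx J d).
Proof.
apply/matrixP => i j; rewrite conjmxE !mxE eq_sym.
by case: eqVneq => [->|_]; rewrite ?mulr1n ?mulr0n ?invo0.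
Qed.

Lemma conjmx_block m n p q (a : 'M[D]_(m, n)) (b : 'M[D]_(m, p))
    (c : 'M[D]_(q, n)) (d : 'M[D]_(q, p)) :
  conjmx J (block_mx a b c d) =
  block_mx (conjmx J a) (conjmx J c) (conjmx J b) (conjmx J d).
Proof. by rewrite /conjmx tr_block_mx map_block_mx. Qed.

Lemma conjmx_row m n p (a : 'M[D]_(m, n)) (b : 'M[D]_(m, p)) :
  conjmx J (row_mx a b) = col_mx (conjmx J a) (conjmx J b).
Proof. by rewrite /conjmx tr_row_mx map_col_mx. Qed.

Lemma mx_inverse_conj m n (a : 'M[D]_(m, n)) b :
  mx_inverse a b -> mx_inverse (conjmx J b) (conjmx J a).
Proof. by move=> [ab ba]; split; rewrite -conjmxM ?ab ?ba conjmx1. Qed.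

Lemma mx_inverse_hermitian n (t s : 'M[D]_n) :
  conjmx J t = t -> mx_inverse t s -> conjmx J s = s.
Proof.
move=> ht ts; have := mx_inverse_conj ts; rewrite ht.
by move/mx_inverse_sym/mx_inverse_uniq; apply.
Qed.

Lemma mk_formP n (t : 'M[D]_n) : conjmx J t = t -> (exists s, mx_inverse t s) ->
  is_form J (Tagged (fun n => 'M[D]_n) t).
Proof. by move=> ht it; apply/asboolP. Qed.

Definition mk_form n (t : 'M[D]_n) ht it : form J :=
  exist (fun t => is_true (is_form J t)) _ (@mk_formP n t ht it).

Lemma fmx_hermitian (t : form J) : conjmx J (fmx t) = fmx t.
Proof. by have /asboolP[] := valP t. Qed.

Lemma fmx_inverse (t : form J) : exists s, mx_inverse (fmx t) s.
Proof. by have /asboolP[] := valP t. Qed.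

Lemma isometric_refl n (t : 'M[D]_n) : isometric J t t.
Proof.
by exists 1%:M, 1%:M; split; [split; rewrite mulmx1 | rewrite conjmx1 mulmx1 mul1mx].
Qed.

Lemma wclass_sum (r s t : form J) :
  isometric J (fmx r) (block_mx (fmx s) 0 0 (fmx t)) ->
  wclass r = wclass s + wclass t.
Proof.
move=> rst; apply/eqP; rewrite -subr_eq0 opprD addrA /wclass -!raddfB.
rewrite -(raddf0 \pi_(witt J)); apply/eqP/eqP; rewrite -Quotient.idealrBE subr0.
by apply/asboolP => K KS _ _; apply: KS; left; exists r, s, t.
Qed.

Lemma wclass_hyp (r : form J) n : isometric J (fmx r) (hyp_mx D n) -> wclass r = 0.
Proof.
move=> rh; rewrite -(raddf0 \pi_(witt J)); apply/eqP; rewrite -Quotient.idealrBE subr0.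
by apply/asboolP => K KS _ _; apply: KS; right; exists r, n.
Qed.

Lemma form0_subproof :
  conjmx J (0 : 'M[D]_0) = 0 /\ exists s, mx_inverse (0 : 'M[D]_0) s.
Proof.
by split; [apply/matrixP => -[] | exists 0; split; apply/matrixP => -[]].
Qed.
Definition form0 : form J := mk_form form0_subproof.1 form0_subproof.2.

Lemma wclass0 : wclass form0 = 0.
Proof.
apply: (@wclass_hyp _ 0); rewrite (_ : hyp_mx D 0 = fmx form0).
  exact: isometric_refl.
by apply/matrixP => -[].
Qed.

Lemma wclass_isometric (r s : form J) :
  isometric J (fmx r) (fmx s) -> wclass r = wclass s.
Proof.
move=> [a [b [[ab ba] ars]]]; rewrite -[RHS]addr0 -wclass0; apply: wclass_sum.
exists (row_mx a 0), (col_mx b 0); split; first split.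
- by rewrite mul_row_col mulmx0 addr0.
- rewrite mul_col_row ba !mulmx0 mul0mx scalar_mx_block; congr block_mx.
  by apply/matrixP => -[].
- rewrite conjmx_row mul_col_mx mul_col_row ars !mulmx0 conjmx0 !mul0mx; congr block_mx.
Qed.

Lemma mx_inverse_block m n (a a' : 'M[D]_m) (b b' : 'M[D]_n) :
  mx_inverse a a' -> mx_inverse b b' ->
  mx_inverse (block_mx a 0 0 b) (block_mx a' 0 0 b').
Proof.
move=> [aa' a'a] [bb' b'b].
split; rewrite mulmx_block !mulmx0 !mul0mx !addr0 !add0r ?aa' ?bb' ?a'a ?b'b;
  by rewrite -scalar_mx_block.
Qed.

Lemma form_sum_subproof (s t : form J) : let r := block_mx (fmx s) 0 0 (fmx t) in
  conjmx J r = r /\ exists r', mx_inverse r r'.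
Proof.
rewrite /= conjmx_block !conjmx0 !fmx_hermitian; split=> //.
have [[s' ss'] [t' tt']] := (fmx_inverse s, fmx_inverse t).
by exists (block_mx s' 0 0 t'); exact: mx_inverse_block.
Qed.
Definition form_sum (s t : form J) : form J :=
  mk_form (form_sum_subproof s t).1 (form_sum_subproof s t).2.

Lemma dimD s t : dim (form_sum s t) = (dim s + dim t)%N.
Proof. by []. Qed.

Lemma wclassD s t : wclass (form_sum s t) = wclass s + wclass t.
Proof. exact/wclass_sum/isometric_refl. Qed.

Lemma form_opp_subproof (t : form J) :
  conjmx J (- fmx t) = - fmx t /\ exists s, mx_inverse (- fmx t) s.
Proof.
rewrite conjmxN fmx_hermitian; split=> //.
by have [s ts] := fmx_inverse t; exists (- s); exact: mx_inverseN.
Qed.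
Definition form_opp (t : form J) : form J :=
  mk_form (form_opp_subproof t).1 (form_opp_subproof t).2.

(** t is isometric to t^-1 by the change of basis t^-1. This is how a form is given
   the opposite determinant without changing its Witt class. *)
Lemma form_inv_ex (t : form J) : exists2 s : form J, wclass s = wclass t &
  dim s = dim t /\ forall x, has_det (fmx t) x -> has_det (fmx s) (- x).
Proof.
have [s ts] := fmx_inverse t.
have hs := mx_inverse_hermitian (fmx_hermitian t) ts.
have iso : isometric J (fmx t) s.
  exists s, (fmx t); split; first exact: mx_inverse_sym.
  by rewrite hs; case: ts => _ ->; rewrite mul1mx.
exists (mk_form hs (ex_intro _ _ (mx_inverse_sym ts))).
  exact/esym/wclass_isometric.
by split=> // x; exact: has_det_inv.
Qed.

Lemma form1_subproof : conjmx J (1%:M : 'M[D]_1) = 1%:M /\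
  exists s, mx_inverse (1%:M : 'M[D]_1) s.
Proof. by rewrite conjmx1; split=> //; exists 1%:M; split; rewrite mulmx1. Qed.
Definition form1 : form J := mk_form form1_subproof.1 form1_subproof.2.

Lemma hyp_form_subproof : conjmx J (hyp_mx D 1) = hyp_mx D 1 /\
  exists s, mx_inverse (hyp_mx D 1) s.
Proof.
rewrite conjmx_block !conjmx0 !conjmx1; split=> //; exists (hyp_mx D 1).
split; rewrite mulmx_block !(mulmx0, mul0mx, mulmx1, addr0, add0r);
  by rewrite -scalar_mx_block.
Qed.
Definition hyp_form : form J := mk_form hyp_form_subproof.1 hyp_form_subproof.2.

Lemma wclass_hyp_form : wclass hyp_form = 0.
Proof. exact/(@wclass_hyp _ 1)/isometric_refl. Qed.

(** The Weyl element u l u, with entries 1 and -1, differs from the hyperbolic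
   plane by diag(1, -1). *)
Lemma has_det_hyp_form : has_det (fmx hyp_form) (k1 (-1)).
Proof.
pose u : 'M[D]_(1 + 1) := block_mx 1%:M (- 1%:M) 0 1%:M.
pose l : 'M[D]_(1 + 1) := block_mx 1%:M 0 1%:M 1%:M.
have -> : fmx hyp_form = u *m l *m u *m block_mx 1%:M 0 0 (- 1%:M).
  rewrite !mulmx_block !(mulmx0, mul0mx, mulmx1, mul1mx, addr0, add0r).
  by rewrite !(mulmxN, mulmx1, mulNmx, mul1mx, opprK, addNr, subrr, addr0, add0r,
    oppr0).
have -> : k1 (-1 : D) = 0 + 0 + 0 + (0 + k1 (-1 : D) *+ 1).
  by rewrite !add0r.
apply: has_detM; last exact/has_det_block/has_detN1/has_det1.
apply: has_detM; last exact/has_det_elementary/elementary_upper.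
apply: has_detM; first exact/has_det_elementary/elementary_upper.
exact/has_det_elementary/elementary_lower.
Qed.

Definition form_mul (t : form J) n : form J := iter n (form_sum t) form0.

Lemma wclass_mul t n : wclass (form_mul t n) = wclass t *+ n.
Proof.
elim: n => [|n IH]; first by rewrite wclass0.
by rewrite [form_mul _ _]/= wclassD IH mulrS.
Qed.

Lemma dim_mul t n : dim (form_mul t n) = (n * dim t)%N.
Proof. by elim: n => //= n IH; rewrite mulSn -IH. Qed.

Lemma has_det_mul t n x : has_det (fmx t) x -> has_det (fmx (form_mul t n)) (x *+ n).
Proof.
move=> hx; elim: n => [|n IH].
  by rewrite mulr0n (_ : fmx _ = 1%:M); [exact: has_det1 | apply/matrixP => -[]].
by rewrite mulrS; exact: has_det_block.
Qed.
End Forms.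

(** * The Witt group modulo II *)

Section WittModuloII.
Variables (D : unitRingType) (J : involution D).

Definition witt_mod := Quotient.quot (zspan (@II_gen D J)).
HB.instance Definition _ := GRing.Zmodule.on witt_mod.
Definition witt_pi (x : witt J) : witt_mod :=
  \pi_(Quotient.quot (zspan (@II_gen D J))) x.

Lemma witt_pi_zmod_morphism : zmod_morphism witt_pi.
Proof. by move=> x y; rewrite /witt_pi raddfB. Qed.
HB.instance Definition _ := GRing.isZmodMorphism.Build
  (witt J) witt_mod witt_pi witt_pi_zmod_morphism.

Lemma witt_pi_eq0 x : witt_pi x = 0 <-> zspan (@II_gen D J) x.
Proof.
rewrite -(raddf0 witt_pi); split=> [/eqP|hx]; last apply/eqP.
  by rewrite -Quotient.idealrBE subr0.
by rewrite -Quotient.idealrBE subr0.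
Qed.

Lemma witt_pi_repr (x : witt_mod) : witt_pi (repr x) = x.
Proof. exact: reprK. Qed.

Lemma witt_pi_form_eq0 (t : form J) :
  (4 %| dim t)%N -> has_det (fmx t) 0 -> witt_pi (wclass t) = 0.
Proof.
move=> t4 dt; apply/witt_pi_eq0/asboolP => K KS _ _; apply: KS.
by exists t; split=> //; exact: has_det0_dieudonne.
Qed.

(** What remains of the class of t modulo II once its dimension is removed; by
   [disc_uniq] it depends only on the determinant. *)
Definition disc (t : form J) : witt_mod :=
  witt_pi (wclass t) - witt_pi (wclass (form1 J)) *+ dim t.

Hypothesis D_division : forall a : D, a != 0 -> a \is a GRing.unit.

Lemma form_has_det (t : form J) : exists x, has_det (fmx t) x.
Proof. by have [s ts] := fmx_inverse t; exact: has_det_ex ts. Qed.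

(** With n = dim t, the form t^-1 + (-t) + n hyperbolic planes has dimension 4n and
   determinant 2n k1(-1) = 0, so its class is in II. *)
Lemma witt_pi_opp (t : form J) : witt_pi (wclass (form_opp t)) = - witt_pi (wclass t).
Proof.
have [x tx] := form_has_det t; have [s <- [ds hs]] := form_inv_ex t.
apply/eqP; rewrite -addr_eq0 addrC -raddfD /= -wclassD.
rewrite -[X in witt_pi X]addr0 -(mul0rn _ (dim t)) -(wclass_hyp_form J) -wclass_mul.
rewrite -wclassD; apply/eqP/witt_pi_form_eq0.
  rewrite !dimD dim_mul -[dim (form_opp t)]/(dim t) ds -[dim (hyp_form J)]/2%N.
  by rewrite addnn -muln2 -mulnDr dvdn_mull.
have -> : 0 = - x + (k1 (-1 : D) *+ dim t + x) + k1 (-1 : D) *+ dim t.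
  by rewrite addrCA addNr addr0 -mulrnDl k1N1 mul0rn.
apply: has_det_block; last exact/has_det_mul/has_det_hyp_form.
by apply: has_det_block; [exact: hs | exact: has_detN].
Qed.

(** Add to t + n'<1> the opposite of t'^-1 + n<1>: the determinants x and -x cancel
   up to k1(-1) *+ N, where N = n + n'. Adding N hyperbolic planes makes the
   dimension 4N and the determinant trivial. *)
Lemma disc_uniq (t t' : form J) x :
  has_det (fmx t) x -> has_det (fmx t') x -> disc t = disc t'.
Proof.
move=> tx tx'; have [s sE [ds /(_ _ tx') hs]] := form_inv_ex t'.
pose one n := form_mul (form1 J) n; pose N := (dim t + dim t')%N.
have det_one n : has_det (fmx (one n)) 0.
  by rewrite -(mul0rn _ n); apply: has_det_mul; exact: has_det1.
pose v := form_sum s (one (dim t)).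
have dv : dim v = N by rewrite dimD dim_mul muln1 ds addnC.
pose u := form_sum (form_sum (form_sum t (one (dim t'))) (form_opp v))
                   (form_mul (hyp_form J) N).
have : witt_pi (wclass u) = 0.
  apply: witt_pi_form_eq0.
    rewrite !dimD !dim_mul -[dim (form_opp v)]/(dim v) dv muln1 -/N.
    by rewrite -[dim (hyp_form J)]/2%N addnn -muln2 -mulnDr dvdn_mull.
  have -> : 0 = x + 0 + (k1 (-1 : D) *+ N + (- x + 0)) + k1 (-1 : D) *+ N.
    by rewrite !addr0 addrCA addrN addr0 -mulrnDl k1N1 mul0rn.
  apply: has_det_block; last exact/has_det_mul/has_det_hyp_form.
  apply: has_det_block; first exact: has_det_block.
  by rewrite -dv; apply: has_detN; exact: has_det_block.
set o := witt_pi (wclass (form1 J)).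
have w_one r n : witt_pi (wclass (form_sum r (one n))) = witt_pi (wclass r) + o *+ n.
  by rewrite wclassD wclass_mul raddfD raddfMn.
rewrite wclassD wclass_mul wclass_hyp_form mul0rn addr0 wclassD raddfD /= witt_pi_opp.
rewrite !w_one sE => /eqP; rewrite subr_eq0 => /eqP e.
by apply/eqP; rewrite /disc subr_eq addrAC eq_sym subr_eq; apply/eqP.
Qed.

Lemma discD (t t' : form J) : disc (form_sum t t') = disc t + disc t'.
Proof. by rewrite /disc wclassD raddfD /= mulrnDr opprD addrACA. Qed.

(** The subgroup Sigma of K_1(D): the domain on which a class modulo II can be read
   off from a determinant. *)
Definition form_dets : {pred K1 D} := fun x =>
  `[< exists t : form J, has_det (fmx t) x >].

Lemma form_dets_zmod_closed : zmod_closed form_dets.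
Proof.
split; first by apply/asboolP; exists (form1 J); exact: has_det1.
move=> x y /asboolP[t tx] /asboolP[s sy]; apply/asboolP.
have [r _ [_ hr]] := form_inv_ex s.
by exists (form_sum t r); apply: has_det_block => //; exact: hr.
Qed.
HB.instance Definition _ := GRing.isZmodClosed.Build (K1 D) form_dets
  form_dets_zmod_closed.

(** The homomorphism Sigma -> W/II with [t] = dim(t) [1] + det_disc (det t). *)
Definition det_disc (x : K1 D) : witt_mod :=
  xget 0 [set w | exists t : form J, has_det (fmx t) x /\ w = disc t].

Lemma det_discE (t : form J) x : has_det (fmx t) x -> det_disc x = disc t.
Proof.
move=> tx; rewrite /det_disc; case: xgetP => [_ _ [s [sx ->]]|/(_ (disc t))[]].
  exact: disc_uniq sx tx.
by exists t.
Qed.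

Lemma det_discD x y : x \in form_dets -> y \in form_dets ->
  det_disc (x + y) = det_disc x + det_disc y.
Proof.
move=> /asboolP[t tx] /asboolP[s sy].
by rewrite (det_discE tx) (det_discE sy) -discD; apply: det_discE; exact: has_det_block.
Qed.

Lemma det_disc0 : det_disc 0 = 0.
Proof.
by apply: (addIr (det_disc 0)); rewrite -det_discD ?addr0 ?add0r ?rpred0.
Qed.

Lemma elementary_conj n (e : 'M[D]_n) : elementary e -> elementary (conjmx J e).
Proof.
elim=> [|i j a {}e ij _ IH]; first by rewrite conjmx1; exact: elementary1.
rewrite conjmxM; apply: elementary_mul => //.
rewrite (_ : conjmx J _ = 1%:M + J a *: delta_mx j i).
  by apply: elementary_gen; rewrite eq_sym.
have invo_nat (b : bool) : J b%:R = b%:R by case: b; rewrite ?invo1 ?invo0.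
apply/matrixP => p q; rewrite conjmxE !mxE invoD invoM andbC !invo_nat eq_sym.
congr (_ + _).
by case: (_ && _); rewrite ?(mulr1, mul1r, mulr0, mul0r).
Qed.

Lemma has_det_conj n (A : 'M[D]_n) x : has_det A x ->
  exists y, has_det (conjmx J A) y.
Proof.
move=> [e [d [he ud -> _]]]; rewrite conjmxM conjmx_diag.
exists (\sum_i k1 ((map_mx J d) 0 i) + 0); apply: has_detM.
  by apply: has_det_diag => i; rewrite mxE invo_unit.
exact/has_det_elementary/elementary_conj.
Qed.

(** A^J A is isometric to the identity matrix. *)
Lemma det_disc_norm n (A : 'M[D]_n) x y : has_det A x -> has_det (conjmx J A) y ->
  y + x \in form_dets /\ det_disc (y + x) = 0.
Proof.
move=> Ax Ay; have hT := has_detM Ay Ax.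
have [B AB] := has_det_invertible Ax.
have iT : exists s, mx_inverse (conjmx J A *m A) s.
  by exists (B *m conjmx J B); exact/mx_inverseM/AB/mx_inverse_sym/mx_inverse_conj.
have sT : conjmx J (conjmx J A *m A) = conjmx J A *m A by rewrite conjmxM conjmxK.
have i1 : exists s, mx_inverse (1%:M : 'M[D]_n) s.
  by exists 1%:M; split; rewrite mulmx1.
pose t := mk_form sT iT; pose o := mk_form (conjmx1 J n) i1.
split; first by apply/asboolP; exists t.
rewrite (det_discE (t := t) hT) -det_disc0 (det_discE (t := o) (has_det1 D n)) /disc.
congr (witt_pi _ - _); apply/esym/wclass_isometric; exists A, B; split=> //.
by rewrite mulmx1.
Qed.

(** In K_1(D) the determinant of (A^J)^-1 B C^-1 is a + b - c minus the norm
   det (A^J A), which [det_disc] kills; A^J has been traded for A. *)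
Lemma disc_det (t : form J) (A A' B C C' : 'M[D]_(dim t)) a b c :
  fmx t = A' *m B *m C' -> mx_inverse (conjmx J A) A' -> mx_inverse C C' ->
  has_det A a -> has_det B b -> has_det C c ->
  a + b - c \in form_dets /\ disc t = det_disc (a + b - c).
Proof.
move=> tE AA' CC' Aa Bb Cc; have [y Ay] := has_det_conj Aa.
have ty : has_det (fmx t) (- y + b - c).
  rewrite tE; apply: has_detM; last exact: has_det_inv Cc.
  by apply: has_detM => //; exact: has_det_inv Ay.
have [es e0] := det_disc_norm Aa Ay.
have ts : - y + b - c \in form_dets by apply/asboolP; exists t.
have -> : a + b - c = (y + a) + (- y + b - c).
  by rewrite -!addrA [X in _ = y + X]addrCA addNKr.
split; first by rewrite rpredD.
by rewrite det_discD // e0 add0r; apply/esym/det_discE.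
Qed.
End WittModuloII.

(** * Bases of right modules *)

Section RightModule.
Variables (D : unitRingType) (M : lmodType D^c).
Implicit Types u v : M.

Lemma rscaleDl u v (a : D) : (u + v) *> a = u *> a + v *> a.
Proof. exact: scalerDr. Qed.

Lemma rscaleDr u (a b : D) : u *> (a + b) = u *> a + u *> b.
Proof. exact: scalerDl. Qed.

Lemma rscaleA u (a b : D) : u *> a *> b = u *> (a * b).
Proof. exact: scalerA. Qed.

Lemma rscale1 u : u *> 1 = u.
Proof. exact: scale1r. Qed.

Lemma rscale0 (a : D) : (0 : M) *> a = 0.
Proof. exact: scaler0. Qed.

Lemma rscaler0 u : u *> 0 = 0.
Proof. exact: scale0r. Qed.

Lemma rscaleN u (a : D) : u *> (- a) = - (u *> a).
Proof. exact: scaleNr. Qed.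

Lemma rscale_suml I r (P : pred I) (f : I -> M) (a : D) :
  (\sum_(i <- r | P i) f i) *> a = \sum_(i <- r | P i) f i *> a.
Proof. exact: scaler_sumr. Qed.

Lemma rscale_sumr I r (P : pred I) (f : I -> D) u :
  u *> (\sum_(i <- r | P i) f i) = \sum_(i <- r | P i) u *> f i.
Proof. exact: scaler_suml. Qed.

Definition lincombs m n (x : 'I_m -> M) (a : 'M[D]_(m, n)) (j : 'I_n) : M :=
  \sum_i x i *> a i j.

Lemma lincombs_mul m n p (x : 'I_m -> M) (a : 'M[D]_(m, n)) (b : 'M[D]_(n, p)) :
  lincombs (lincombs x a) b =1 lincombs x (a *m b).
Proof.
move=> j; rewrite /lincombs; under eq_bigr do rewrite rscale_suml.
rewrite exchange_big; apply: eq_bigr => i _; rewrite mxE rscale_sumr.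
by apply: eq_bigr => k _; rewrite rscaleA.
Qed.

Lemma lincombs1 n (x : 'I_n -> M) : lincombs x 1%:M =1 x.
Proof.
move=> j; rewrite /lincombs (bigD1 j) //= big1 ?addr0 => [|i ij].
  by rewrite mxE eqxx rscale1.
by rewrite mxE (negPf ij) rscaler0.
Qed.

Lemma eq_lincombs m n (x y : 'I_m -> M) (a : 'M[D]_(m, n)) : x =1 y -> lincombs x a =1 lincombs y a.
Proof. by move=> xy j; apply: eq_bigr => i _; rewrite xy. Qed.

Lemma lincombE n (x : 'I_n -> M) (c : 'cV[D]_n) : lincomb x c = lincombs x c 0.
Proof. by []. Qed.

Lemma lincombs_col m n (x : 'I_m -> M) (a : 'M[D]_(m, n)) j :
  lincombs x a j = lincomb x (col j a).
Proof. by apply: eq_bigr => i _; rewrite mxE. Qed.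

Lemma lincombs_ex m n (x : 'I_m -> M) (y : 'I_n -> M) :
  (forall j, range (lincomb x) (y j)) -> exists a, y =1 lincombs x a.
Proof.
move=> xy.
have [c cE] := choice (fun j => let: ex_intro2 c _ e := xy j in ex_intro _ c e).
exists (\matrix_(i, j) c j i 0) => j; rewrite -cE.
by apply: eq_bigr => i _; rewrite mxE.
Qed.

Lemma basis_of_mem n (x : 'I_n -> M) X i : basis_of x X -> X (x i).
Proof.
move=> [_ <-]; exists (delta_mx i 0) => //.
rewrite lincombE -(lincombs1 x i) !lincombs_col; congr lincomb.
by apply/colP => k; rewrite !mxE eqxx andbT.
Qed.

Lemma lincombs_inj m n (x : 'I_m -> M) X (a b : 'M[D]_(m, n)) : basis_of x X ->
  lincombs x a =1 lincombs x b -> a = b.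
Proof.
move=> [xi _] ab; apply/matrixP => i j.
have /xi/matrixP/(_ i 0) : lincomb x (col j a) = lincomb x (col j b).
  by rewrite -!lincombs_col.
by rewrite !mxE.
Qed.

Lemma basis_change m n (x : 'I_m -> M) (y : 'I_n -> M) X :
  basis_of x X -> basis_of y X -> exists a b, mx_inverse a b /\ y =1 lincombs x a.
Proof.
move=> bx bY'; have [[xi xX] [yi yX]] := (bx, bY').
have [a ya] : exists a, y =1 lincombs x a.
  by apply: lincombs_ex => j; rewrite xX; exact: basis_of_mem bY'.
have [b xb] : exists b, x =1 lincombs y b.
  by apply: lincombs_ex => j; rewrite yX; exact: basis_of_mem bx.
exists a, b; split=> //; split.
  apply: (lincombs_inj bx) => j; rewrite -lincombs_mul lincombs1 [RHS]xb.
  by apply/esym/eq_lincombs.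
apply: (lincombs_inj bY') => j; rewrite -lincombs_mul lincombs1 [RHS]ya.
by apply/esym/eq_lincombs.
Qed.

Lemma basis_of_lincombs m n (x : 'I_m -> M) X (a : 'M[D]_(m, n)) b :
  mx_inverse a b -> basis_of x X -> basis_of (lincombs x a) X.
Proof.
move=> [ab ba] [xi xX]; split=> [c d|].
  rewrite !lincombE !lincombs_mul -!lincombE => /xi /(congr1 (mulmx b)).
  by rewrite !mulmxA ba !mul1mx.
rewrite -xX; apply/seteqP; split=> _ [c _ <-].
  by exists (a *m c) => //; rewrite !lincombE lincombs_mul.
by exists (b *m c) => //; rewrite !lincombE lincombs_mul mulmxA ab mul1mx.
Qed.

Lemma eq_basis_of n (x y : 'I_n -> M) X : x =1 y -> basis_of x X -> basis_of y X.
Proof. by move=> xy; rewrite (_ : y = x) //; apply/funext => i. Qed.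
End RightModule.

(** * Gram matrices and the invariant kappa *)

Section Gram.
Variables (D : unitRingType) (J : involution D).
Variables (M : lmodType D^c) (h : M -> M -> D).
Hypothesis h_hermitian : delta_hermitian J (-1) h.
Implicit Types u v w : M.

Lemma hDl u v w : h (u + v) w = h u w + h v w.
Proof. by case: h_hermitian. Qed.

Lemma hDr u v w : h u (v + w) = h u v + h u w.
Proof. by case: h_hermitian. Qed.

Lemma hC u v : h u v = - J (h v u).
Proof. by case: h_hermitian => _ _ _ ->; rewrite mulrN1. Qed.

Lemma hZr u v a : h u (v *> a) = h u v * a.
Proof.
by case: h_hermitian => _ _ hZ _; rewrite -[u in LHS]rscale1 hZ invo1 mul1r.
Qed.

Lemma hZl u v a : h (u *> a) v = J a * h u v.
Proof.
by case: h_hermitian => _ _ hZ _; rewrite -[v in LHS]rscale1 hZ mulr1.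
Qed.

Lemma h0l u : h 0 u = 0.
Proof. by apply: (addIr (h 0 u)); rewrite -hDl !add0r. Qed.

Lemma h0r u : h u 0 = 0.
Proof. by apply: (addIr (h u 0)); rewrite -hDr !add0r. Qed.

Lemma hNr u v : h u (- v) = - h u v.
Proof. by apply: (addIr (h u v)); rewrite -hDr !addNr h0r. Qed.

Lemma h_sumr I r (P : pred I) (f : I -> M) u :
  h u (\sum_(i <- r | P i) f i) = \sum_(i <- r | P i) h u (f i).
Proof. exact: (big_morph (h u) (hDr u) (h0r u)). Qed.

Lemma h_suml I r (P : pred I) (f : I -> M) u :
  h (\sum_(i <- r | P i) f i) u = \sum_(i <- r | P i) h (f i) u.
Proof. exact: (big_morph (h^~ u) (fun v w => hDl v w u) (h0l u)). Qed.

Definition gram m n (x : 'I_m -> M) (y : 'I_n -> M) : 'M[D]_(m, n) :=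
  \matrix_(i, j) h (x i) (y j).

Lemma gramC m n (x : 'I_m -> M) (y : 'I_n -> M) : gram y x = - conjmx J (gram x y).
Proof. by apply/matrixP => i j; rewrite !mxE hC. Qed.

Lemma eq_gram m n (x x' : 'I_m -> M) (y y' : 'I_n -> M) :
  x =1 x' -> y =1 y' -> gram x y = gram x' y'.
Proof. by move=> xx' yy'; apply/matrixP => i j; rewrite !mxE xx' yy'. Qed.

Lemma gram_lincombsr m n p (x : 'I_m -> M) (y : 'I_n -> M) (b : 'M[D]_(n, p)) :
  gram x (lincombs y b) = gram x y *m b.
Proof.
apply/matrixP => i j; rewrite !mxE h_sumr; apply: eq_bigr => k _.
by rewrite mxE hZr.
Qed.

Lemma gram_lincombsl m n p (x : 'I_m -> M) (y : 'I_n -> M) (a : 'M[D]_(m, p)) :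
  gram (lincombs x a) y = conjmx J a *m gram x y.
Proof. by rewrite gramC gram_lincombsr conjmxM -mulmxN -gramC. Qed.

Lemma gramDr m n (x : 'I_m -> M) (y z : 'I_n -> M) :
  gram x (fun j => y j + z j) = gram x y + gram x z.
Proof. by apply/matrixP => i j; rewrite !mxE hDr. Qed.

Lemma gramDl m n (x : 'I_m -> M) (y z : 'I_n -> M) :
  gram (fun j => y j + z j) x = gram y x + gram z x.
Proof. by apply/matrixP => i j; rewrite !mxE hDl. Qed.

Lemma opposite_sym (X Y : lagrangian h) : opposite X Y -> opposite Y X.
Proof. by rewrite /opposite setIC. Qed.

Lemma lagrangianE (X : lagrangian h) : val X = orthogonal h (val X).
Proof. by have /asboolP[] := valP X. Qed.

Lemma lagrangian_subspace (X : lagrangian h) : subspace (val X).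
Proof. by have /asboolP[] := valP X. Qed.

Lemma gram_lagrangian n (x y : 'I_n -> M) (X : lagrangian h) :
  basis_of x (val X) -> basis_of y (val X) -> gram x y = 0.
Proof.
move=> bx bY; apply/matrixP => i j; rewrite !mxE.
have := basis_of_mem j bY; rewrite lagrangianE; apply.
exact: basis_of_mem bx.
Qed.

Lemma orthogonal_basis n (x : 'I_n -> M) (X : lagrangian h) v :
  basis_of x (val X) -> (forall i, h (x i) v = 0) -> val X v.
Proof.
move=> [_ xX] xv; rewrite lagrangianE -xX => _ [c _ <-].
by rewrite h_suml big1 // => i _; rewrite hZl xv mulr0.
Qed.

Hypothesis D_division : forall a : D, a != 0 -> a \is a GRing.unit.

(** A vector in the kernel of the Gram matrix would give a vector of Y orthogonal
   to X, that is one of X. *)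
Lemma gram_opposite n (x y : 'I_n -> M) (X Y : lagrangian h) :
  basis_of x (val X) -> basis_of y (val Y) -> opposite X Y ->
  exists d, has_det (gram x y) d.
Proof.
move=> bx bY XY; case: (has_det_or_kernel D_division (gram x y)) => // -[c c0 gc].
suff c_eq0 : c = 0 by rewrite c_eq0 eqxx in c0.
have [yi yY] := bY; apply: yi.
have : (val X `&` val Y) (lincomb y c).
  split; last by rewrite -yY; exists c.
  apply: (orthogonal_basis bx) => i; have /matrixP/(_ i 0) := gc.
  by rewrite -gram_lincombsr !mxE.
rewrite XY => ->; rewrite /lincomb big1 // => i _.
by rewrite mxE rscaler0.
Qed.

(** The basis y' of Y dual to x and the basis z' of Z with h(x, z') = -1 satisfy
   z' - y' in X, because that difference is orthogonal to X; t = h(y', z') then is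
   the matrix wanted. *)
Lemma kappa_ex n (x y z : 'I_n -> M) (X Y Z : lagrangian h) A' C' :
  basis_of x (val X) -> basis_of y (val Y) -> basis_of z (val Z) ->
  opposite Y Z ->
  mx_inverse (conjmx J (gram x y)) A' -> mx_inverse (gram x z) C' ->
  exists (st : conjmx J (A' *m gram y z *m C') = _) it,
    kappa X Y Z (@mk_form D J n (A' *m gram y z *m C') st it).
Proof.
move=> bx bY bz YZ AA' CC'; set t := A' *m _ *m C'.
pose y' := lincombs y (- conjmx J A'); pose z' := lincombs z (- C').
have bY' : basis_of y' (val Y).
  apply: basis_of_lincombs bY; apply: mx_inverseN; apply: mx_inverse_conj AA'.
have bz' : basis_of z' (val Z).
  by apply: basis_of_lincombs bz; apply: mx_inverseN; exact: mx_inverse_sym CC'.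
have y'x : gram y' x = 1%:M.
  by rewrite gram_lincombsl conjmxN conjmxK gramC mulmxN mulNmx opprK; case: AA'.
have xz' : gram x z' = - 1%:M.
  by rewrite gram_lincombsr mulmxN; case: CC' => ->.
have [t' z'E] : exists t', (fun j => z' j - y' j) =1 lincombs x t'.
  apply: lincombs_ex => j; case: (bx) => _ ->; apply: (orthogonal_basis bx) => i.
  have /matrixP/(_ i j) := xz'; have /matrixP/(_ i j) := gramC y' x.
  by rewrite y'x conjmx1 hDr hNr !mxE => -> ->; rewrite subrr.
have {}z'E : z' =1 fun j => y' j + lincombs x t' j.
  by move=> j; rewrite -z'E addrC subrK.
have tE : t' = t.
  have : gram y' z' = t.
    by rewrite gram_lincombsr gram_lincombsl mulmxN conjmxN conjmxK !mulNmx opprK.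
  rewrite (eq_gram (frefl y') z'E) gramDr gram_lincombsr y'x mul1mx.
  by rewrite (gram_lagrangian bY' bY') add0r.
rewrite {}tE in z'E; clearbody y' z'.
have st : conjmx J t = t.
  have := gram_lagrangian bz' bz'; rewrite (eq_gram z'E z'E) gramDr !gramDl.
  rewrite !gram_lincombsr !gram_lincombsl y'x (gram_lagrangian bY' bY').
  rewrite (gram_lagrangian bx bx) mulmx0 mul0mx addr0 mul1mx add0r.
  by rewrite gramC y'x conjmx1 mulmxN mulmx1 addrC => /eqP; rewrite subr_eq0 => /eqP.
have it : exists s, mx_inverse t s.
  have [d hd] := gram_opposite bY bz YZ; have [B' BB'] := has_det_invertible hd.
  exists (gram x z *m (B' *m conjmx J (gram x y))).
  apply: mx_inverseM; last exact: mx_inverse_sym.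
  by apply: mx_inverseM => //; exact: mx_inverse_sym.
exists st, it, x, y'; split=> //.
- by move=> mu nu; have /matrixP/(_ mu nu) := y'x; rewrite !mxE.
- exact: eq_basis_of bz'.
Qed.

(** A change of the basis x of X by a forces the changes of y and z to be by
   (a^J)^-1, since both are dual to x. *)
Lemma kappa_uniq (X Y Z : lagrangian h) (t t' : form J) :
  kappa X Y Z t -> kappa X Y Z t' -> isometric J (fmx t) (fmx t').
Proof.
move=> [x [y [bx bY yx bz]]] [x' [y' [bx' bY' yx' bz']]].
have [a [b [ab x'E]]] := basis_change bx bx'.
have [p [_ [_ y'E]]] := basis_change bY bY'.
have [q [_ [_ z'E]]] := basis_change bz bz'.
set z := fun nu => y nu + _ in bz z'E.
set z' := fun nu => y' nu + _ in bz' z'E.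
have {}yx : gram y x = 1%:M by apply/matrixP => i j; rewrite !mxE.
have {}yx' : gram y' x' = 1%:M by apply/matrixP => i j; rewrite !mxE.
have dual_z n (u v : 'I_n -> M) (U V : lagrangian h) (s : 'M[D]_n) :
    basis_of u (val U) -> basis_of v (val V) -> gram v u = 1%:M ->
    gram (fun j => v j + lincombs u s j) u = 1%:M /\
    gram v (fun j => v j + lincombs u s j) = s.
  move=> bu bv vu; rewrite gramDl gramDr gram_lincombsl gram_lincombsr vu mul1mx.
  by rewrite (gram_lagrangian bu bu) (gram_lagrangian bv bv) mulmx0 addr0 add0r.
have [zx yz] : gram z x = 1%:M /\ gram y z = fmx t.
  exact: (dual_z _ x y X Y).
have [zx' yz'] : gram z' x' = 1%:M /\ gram y' z' = fmx t'.
  exact: (dual_z _ x' y' X Y).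
have inv_a (c : 'M[D]_(dim t, dim t')) : conjmx J c *m a = 1%:M -> c = conjmx J b.
  move=> ca; rewrite -[c](conjmxK J); congr (conjmx J _).
  by case: ab => ab _; rewrite -[LHS]mulmx1 -ab mulmxA ca mul1mx.
have pE : p = conjmx J b.
  by apply: inv_a; rewrite -yx' (eq_gram y'E x'E) gram_lincombsl gram_lincombsr yx mul1mx.
have qE : q = conjmx J b.
  by apply: inv_a; rewrite -zx' (eq_gram z'E x'E) gram_lincombsl gram_lincombsr zx mul1mx.
exists (conjmx J b), (conjmx J a); split; first exact: mx_inverse_conj.
by rewrite -yz' (eq_gram y'E z'E) gram_lincombsl gram_lincombsr yz pE qE mulmxA.
Qed.

Lemma maslov_kappa (X Y Z : lagrangian h) (t : form J) :
  opposite X Y -> opposite Y Z -> opposite X Z -> kappa X Y Z t ->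
  maslov J X Y Z = wclass t.
Proof.
move=> XY YZ XZ kt; rewrite /maslov; case: xgetP => [_ _ [s [_ _ _ ks ->]]|].
  by apply: wclass_isometric; exact: kappa_uniq ks kt.
by move=> /(_ (wclass t)) []; exists t; split.
Qed.

Lemma disc_maslov n (x y z : 'I_n -> M) (X Y Z : lagrangian h) a b c :
  basis_of x (val X) -> basis_of y (val Y) -> basis_of z (val Z) ->
  opposite X Y -> opposite Y Z -> opposite X Z ->
  has_det (gram x y) a -> has_det (gram y z) b -> has_det (gram x z) c ->
  a + b - c \in form_dets J /\
  witt_pi (maslov J X Y Z) = witt_pi (wclass (form1 J)) *+ n + det_disc J (a + b - c).
Proof.
move=> bx bY bz XY YZ XZ ha hb hc.
have [A' /(mx_inverse_conj J)/mx_inverse_sym AA'] := has_det_invertible ha.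
have [C' CC'] := has_det_invertible hc.
have [st [it kt]] := kappa_ex bx bY bz YZ AA' CC'.
set t := mk_form st it in kt.
have [sg dE] := disc_det D_division (t := t) erefl AA' CC' ha hb hc.
by split=> //; rewrite (maslov_kappa XY YZ XZ kt) -dE /disc addrC subrK.
Qed.
End Gram.

(** * Hyperbolic bases *)

Import VectorInternalTheory.

Section HyperbolicBasis.
Variables (D : unitRingType) (J : involution D).
Variables (M : lmodType D^c) (h : M -> M -> D).
Hypothesis h_hermitian : delta_hermitian J (-1) h.
Hypothesis h_hyperbolic : hyperbolic J (-1) h.

(** The diagonal part of a hyperbolic form: h(v, v) = xi(x) - xi(x)^J for
   v = (x, xi). *)
Lemma trace_valued v : exists b, h v v = b - J b.
Proof.
have [X [f [[g fK gK] hf]]] := h_hyperbolic.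
exists (dual_eval (g v).2 (g v).1).
by rewrite -{1 2}(gK v) hf /hyperbolic_form mulrN1.
Qed.

Section Coordinates.
Variables (X : vectType D^c) (i : 'I_(vector.dim X)).
Definition coord_fun (x : X) : (D^c)^o := v2r x 0 i.
Lemma coord_fun_linear : linear coord_fun.
Proof. by move=> a u v; rewrite /coord_fun linearP !mxE. Qed.
HB.instance Definition _ := GRing.isLinear.Build D^c X (D^c)^o *:%R
  coord_fun coord_fun_linear.
End Coordinates.

(** X and X^J with a basis and its dual basis. *)
Lemma hyperbolic_basis : exists n (e f : 'I_n -> M) (X : lagrangian h),
  [/\ basis_of e (val X), forall i j, h (f i) (e j) = (i == j)%:R
    & forall i, h (f i) (f i) = 0].
Proof.
have [X [f [bf hf]]] := h_hyperbolic; have [g fK gK] := bf.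
pose n := vector.dim X.
pose inX (x : X) : M := f (x, 0 : dual J X).
have inXE x y eta : h (inX x) (f (y, eta)) = - J (dual_eval eta x).
  by rewrite hf /hyperbolic_form /= mulrN1 /dual_eval lfunE /= add0r.
have inXD x y : inX (x + y) = inX x + inX y.
  by rewrite /inX -raddfD; congr (f _); congr pair; rewrite addr0.
have inXZ x a : inX (x *> a) = inX x *> a.
  by rewrite /rscale /inX -linearZ; congr (f _); congr pair; rewrite scaler0.
have inX0 : inX 0 = 0 by rewrite /inX -[RHS](raddf0 f).
pose XX : set M := range inX.
have XXl : is_lagrangian h XX.
  apply/asboolP; split; first split.
  - by exists 0.
  - by move=> _ _ [x _ <-] [y _ <-]; exists (x + y).
  - by move=> _ a [x _ <-]; exists (x *> a).
  apply/seteqP; split=> [_ [x _ <-] _ [y _ <-]|v Xv].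
    by rewrite inXE /dual_eval lfunE /= invo0 oppr0.
  exists (g v).1 => //; rewrite -[RHS]gK; congr (f _).
  rewrite [RHS]surjective_pairing; congr pair; apply/esym/dual_evalP => x.
  have : h (inX x) (f ((g v).1, (g v).2)) = 0.
    by rewrite -surjective_pairing gK; apply: Xv; exists x.
  rewrite inXE => /eqP; rewrite oppr_eq0 => /eqP gx.
  by rewrite -[LHS](invoK J) gx invo0 /dual_eval lfunE.
pose e (i : 'I_n) : M := inX (@r2v _ X (delta_mx 0 i : 'rV[D^c]_n)).
pose xi (i : 'I_n) : dual J X := linfun (@coord_fun X i).
have xiE i x : dual_eval (xi i) x = v2r x 0 i by rewrite /dual_eval lfunE.
exists n, e, (fun i => f (0, xi i)), (exist _ XX XXl); split.
- have eE c : lincomb e c = inX (@r2v _ X (\row_j c j 0 : 'rV[D^c]_n)).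
    rewrite [\row_j _](@row_sum_delta D^c) raddf_sum (big_morph inX inXD inX0).
    apply: eq_bigr => j _ /=; rewrite linearZ mxE; exact/esym/inXZ.
  split=> [c d|]; rewrite ?eE.
    move=> /(bij_inj bf) [/(can_inj r2vK)/rowP cd].
    by apply/colP => j; have := cd j; rewrite !mxE.
  apply/seteqP; split=> [_ [c _ <-]|_ [x _ <-]].
    by exists (@r2v _ X (\row_j c j 0 : 'rV[D^c]_n)).
  exists (\col_j v2r x 0 j) => //; rewrite eE; congr inX.
  rewrite -[RHS]v2rK; congr r2v; apply/rowP => j.
  by rewrite !mxE.
- move=> i j; rewrite (hC h_hermitian) inXE xiE r2vK mxE eqxx /=.
  by rewrite invoN opprK invoK.
- move=> i; rewrite hf /hyperbolic_form /= xiE raddf0 mxE.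
  by rewrite invo0 mul0r addr0.
Qed.
End HyperbolicBasis.

(** * Eichler transformations and common opposite Lagrangians *)

Section Eichler.
Variables (D : unitRingType) (J : involution D).
Variables (M : lmodType D^c) (h : M -> M -> D).
Hypothesis h_hermitian : delta_hermitian J (-1) h.
Implicit Types u v w : M.
Notation hDl := (hDl h_hermitian).
Notation hDr := (hDr h_hermitian).
Notation hZl := (hZl h_hermitian).
Notation hZr := (hZr h_hermitian).
Notation hNr := (hNr h_hermitian).
Notation h0l := (h0l h_hermitian).
Notation h0r := (h0r h_hermitian).
Notation hC := (hC h_hermitian).

Lemma hNl u v : h (- u) v = - h u v.
Proof. by apply: (addIr (h u v)); rewrite -hDl !addNr h0l. Qed.

Definition eichler_data u w (a : D) : Prop :=
  [/\ h u u = 0, h u w = 0 & a - J a = h w w].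

(** With the two terms along u collected. *)
Definition eichler_map u w (a : D) v : M := v + w *> h u v + u *> (h w v + a * h u v).

(** For fixed u the Eichler transformations form a group of Heisenberg type. *)
Lemma eichler_mapM u w w' a a' v : eichler_data u w a -> eichler_data u w' a' ->
  eichler_map u w a (eichler_map u w' a' v) =
  eichler_map u (w + w') (a + a' + h w w') v.
Proof.
move=> [uu uw _] [_ uw' _]; have wu : h w u = 0 by rewrite hC uw invo0 oppr0.
rewrite /eichler_map !hDr !hZr uu uw' wu !mul0r !addr0 hDl.
rewrite !rscaleDl -!addrA; congr (_ + _); rewrite [RHS]addrCA; congr (_ + _).
rewrite addrCA; congr (_ + _); rewrite -rscaleDr; congr (_ *> _).
by rewrite !mulrDl !addrA [LHS](ACl (3*1*5*2*4)).
Qed.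

Lemma eichler_map0 u v : eichler_map u 0 0 v = v.
Proof. by rewrite /eichler_map h0l rscale0 mul0r !addr0 rscaler0 addr0. Qed.

Lemma eichler_dataD u w w' a a' : eichler_data u w a -> eichler_data u w' a' ->
  eichler_data u (w + w') (a + a' + h w w').
Proof.
move=> [uu uw aw] [_ uw' aw']; split=> //; first by rewrite hDr uw uw' addr0.
rewrite !hDl !hDr -aw -aw' !invoD [h w' w]hC.
by rewrite !opprD !addrA [LHS](ACl (1*4*3*6*2*5)).
Qed.

Lemma eichler_dataV u w a : eichler_data u w a -> eichler_data u (- w) (h w w - a).
Proof.
move=> [uu uw aw]; split=> //; first by rewrite hNr uw oppr0.
rewrite hNr [h (- w) w]hC hNr invoN !opprK invoD invoN.
have e : h w w - a + J a = 0 by rewrite -aw addrAC subrK subrr.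
by rewrite opprB addrA e add0r.
Qed.

Lemma eichler_isometry u w a : eichler_data u w a -> isometry h (eichler_map u w a).
Proof.
move=> d; have [uu uw aw] := d; have d' := eichler_dataV d.
have wu : h w u = 0 by rewrite hC uw invo0 oppr0.
apply/asboolP; split.
- exists (eichler_map u (- w) (h w w - a)) => v; rewrite eichler_mapM //.
    by rewrite addNr subrK hNl subrr eichler_map0.
  by rewrite subrr hNr addrCA subrr addr0 subrr eichler_map0.
- move=> v v'; rewrite /eichler_map !hDr mulrDr !rscaleDr !addrA.
  by rewrite [LHS](ACl (1*3*5*7*2*4*6*8)).
- by move=> v b; rewrite /eichler_map !hZr mulrA -mulrDl -!rscaleA -!rscaleDl.
- move=> v v'; rewrite /eichler_map.
  set s := h u v; set s' := h u v'; set t := h w v + _; set t' := h w v' + _.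
  rewrite !hDl !hDr !hZl !hZr uu uw wu.
  rewrite -/s' !mul0r !mulr0 !addr0 [h v w]hC [h v u]hC -/s -aw {}/t {}/t'.
  rewrite !(invoD, invoM, mulrDl, mulrDr, mulNr, mulrN, mulrA, opprD, addrA).
  rewrite [LHS](ACl (1*(2*8)*(3*5)*(4*6)*(7*9))) /=.
  by rewrite !addNr !addr0.
Qed.

Definition eichler_unitary u w a (d : eichler_data u w a) : unitary h :=
  exist (fun f => is_true (isometry h f)) _ (eichler_isometry d).

Lemma eichler_unitary_EU u w a (d : eichler_data u w a) :
  @in_EU _ J _ h (eichler_unitary d).
Proof.
apply/asboolP => K KE _ _ _ _; apply: KE; exists u, w, a; case: d => uu uw aw.
by split=> // v; rewrite /= /eichler_map rscaleDr addrA rscaleA.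
Qed.

Definition eichler_EU u w a (d : eichler_data u w a) : EU J h :=
  exist (fun f => is_true (@in_EU _ J _ h f)) _ (eichler_unitary_EU d).

Lemma EU_inj (k l : EU J h) : (forall v, val (val k) v = val (val l) v) -> k = l.
Proof. by move=> kl; do 2!apply: val_inj; apply/funext. Qed.

Lemma transvection_data u a : h u u = 0 -> a = J a -> eichler_data u 0 a.
Proof. by move=> uu aJ; split; rewrite ?h0r // -aJ subrr. Qed.

Hypothesis D_division : forall a : D, a != 0 -> a \is a GRing.unit.

(** Moving V by a transvection along u puts it off Z, except along the part of
   V orthogonal to u, for all but one value of the parameter. If u is not in V + Z
   this is clear. If u = v0 + z0, then w below lies in both V and Z, hence is
   orthogonal to u; this reads (1 + h(u, v0) a) h(u, v) = 0. *)
Lemma transvection_avoid (V Z : lagrangian h) u : exists bad, forall a,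
  a != 0 -> a != bad -> forall v, val V v -> val Z (v + u *> (a * h u v)) -> h u v = 0.
Proof.
have [[V0 VD VZ] [Z0 ZD ZZ]] := (lagrangian_subspace V, lagrangian_subspace Z).
have VN v : val V v -> val V (- v) by rewrite -[- v]scaleN1r; exact: VZ.
have ZN v : val Z v -> val Z (- v) by rewrite -[- v]scaleN1r; exact: ZZ.
have [[v0 [z0 [Vv0 Zz0 uE]]]|nu] :=
    pselect (exists v0 z0, [/\ val V v0, val Z z0 & u = v0 + z0]).
  (* The root of 1 + h(u, v0) a = 0 is the one to be avoided. *)
  exists (- (h u v0)^-1) => a a0 abad v Vv Zv.
  pose w := v + v0 *> (a * h u v).
  have Vw : val V w by apply: VD => //; exact: VZ.
  have Zw : val Z w.
    rewrite (_ : w = v + u *> (a * h u v) - z0 *> (a * h u v)).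
      exact: (ZD _ _ Zv (ZN _ (ZZ _ _ Zz0))).
    by rewrite /w; set c := a * _; rewrite uE rscaleDl addrA addrK.
  have : h u w = 0.
    rewrite uE hDl; have := Vw; rewrite {1}lagrangianE => -> //.
    by have := Zw; rewrite {1}lagrangianE => -> //; rewrite addr0.
  rewrite hDr hZr mulrA -{1}[h u v]mul1r -mulrDl => e.
  apply: contrapT => /eqP/D_division uv; case/eqP: abad.
  move/(congr1 ( *%R^~ (h u v)^-1)): e; rewrite mul0r mulrK // => /eqP.
  rewrite addrC addr_eq0 => /eqP e.
  have u1 : h u v0 * (- a) = 1 by rewrite mulrN e opprK.
  have u2 : h u v0 \is a GRing.unit.
    apply: D_division; apply: contra_eq_neq u1 => ->.
    by rewrite mul0r eq_sym oner_neq0.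
  by apply: (mulrI u2); rewrite e mulrN mulrV.
exists 0 => a a0 _ v Vv Zv; apply: contrapT => /eqP/D_division uv; apply: nu.
set c := a * h u v in Zv; have uc : c \is a GRing.unit.
  by apply: unitMr => //; exact: D_division.
exists (- v *> c^-1), ((v + u *> c) *> c^-1); split.
- by apply: VZ; exact: VN.
- exact: ZZ.
- by rewrite -rscaleDl addKr rscaleA mulrV // rscale1.
Qed.

Hypothesis D1_infinite : infinite_set [set a : D | a = J a].

Lemma infinite_avoid (s : seq D) : exists2 a, a = J a & a \notin s.
Proof.
apply: contra_notP D1_infinite => ns; apply: (@sub_finite_set _ _ [set` s]).
  by move=> a aJ /=; apply: contrapT => /negP as_; apply: ns; exists a.
exact: finite_seq.
Qed.

Lemma transvection_step (V : lagrangian h) (Zs : seq (lagrangian h)) u : h u u = 0 ->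
  exists g : EU J h, forall Z, Z \in Zs ->
    forall v, val V v -> val Z (val (val g) v) -> h u v = 0 /\ val (val g) v = v.
Proof.
move=> uu; have [bad badP] := choice (fun Z => transvection_avoid V Z u).
have [a aJ] := infinite_avoid (0 :: map bad Zs); rewrite inE negb_or => /andP[a0 aZ].
exists (eichler_EU (transvection_data uu aJ)) => Z ZZs v Vv.
rewrite /= /eichler_map h0l rscale0 addr0 add0r => Zv.
have uv : h u v = 0.
  apply: (badP Z a a0 _ v Vv Zv); apply: contraNneq aZ => ->.
  exact: map_f.
by rewrite uv mulr0 rscaler0 addr0.
Qed.

(** Applying the previous step along each u in turn leaves in the intersection with
   every Z only vectors orthogonal to all u: a later step does not move the
   vectors that remain. *)
Lemma transvection_list (us : seq M) (V : lagrangian h) (Zs : seq (lagrangian h)) :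
  (forall u, u \in us -> h u u = 0) ->
  exists g : EU J h, forall Z, Z \in Zs -> forall v,
    val V v -> val Z (val (val g) v) -> forall u, u \in us -> h u (val (val g) v) = 0.
Proof.
elim: us => [|u us IH] us0; first by exists 1%g.
have [|g gP] := IH; first by move=> u' us_u'; apply: us0; rewrite inE us_u' orbT.
have uu : h u u = 0 by apply: us0; rewrite inE eqxx.
have [g' g'P] := transvection_step (lagrangian_act (val g) V) Zs uu.
exists (g' * g)%g => Z ZZs v Vv Zv.
have [uv ev] : h u (val (val g) v) = 0 /\ val (val (g' * g)%g) v = val (val g) v.
  by apply: (g'P Z ZZs) => //; exists v.
rewrite ev in Zv *; move=> u'; rewrite inE => /orP[/eqP->//|].
exact: (gP Z ZZs v).
Qed.

Hypothesis h_hyperbolic : hyperbolic J (-1) h.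

Lemma hyperbolic_isotropic_span : exists us : seq M,
  (forall u, u \in us -> h u u = 0) /\
  (forall v, (forall u, u \in us -> h u v = 0) -> v = 0).
Proof.
have [n [e [f [X [be fe ff]]]]] := hyperbolic_basis h_hermitian h_hyperbolic.
exists (codom e ++ codom f); split=> [u|v uv].
  rewrite mem_cat => /orP[] /codomP[i ->] //.
  have := basis_of_mem i be; rewrite {1}lagrangianE; apply.
  exact: basis_of_mem be.
have ev i : h (e i) v = 0 by apply: uv; rewrite mem_cat codom_f.
have fv i : h (f i) v = 0 by apply: uv; rewrite mem_cat codom_f orbT.
have := orthogonal_basis h_hermitian be ev; case: be => _ <- [c _ cv].
rewrite -cv /lincomb big1 // => i _; rewrite (_ : c i 0 = 0) ?rscaler0 //.
have := fv i; rewrite -cv (h_sumr h_hermitian) (bigD1 i) //= big1 ?addr0 => [|j ji].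
  by rewrite hZr fe eqxx mul1r.
by rewrite hZr fe eq_sym (negPf ji) mul0r.
Qed.

(** Isotropic vectors that span M leave nothing in the intersections. As only
   transvections are used, the common opposite stays in the EU(M)-orbit of V. *)
Lemma common_opposite (V : lagrangian h) (Zs : seq (lagrangian h)) :
  exists g : EU J h, forall Z, Z \in Zs -> opposite (lagrangian_act (val g) V) Z.
Proof.
have [us [us0 usP]] := hyperbolic_isotropic_span.
have [g gP] := transvection_list V Zs us0; exists g => Z ZZs.
apply/seteqP; split=> [_ [[v Vv <-] Zv]|_ ->]; first by apply: usP; exact: (gP Z).
have [[g0 _ _] [Z0 _ _]] :=
  (lagrangian_subspace (lagrangian_act (val g) V), lagrangian_subspace Z).
by split.
Qed.
End Eichler.

(** * EU(M) is perfect *)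

Section JordanInvariant.
Variables (D : unitRingType) (J : involution D) (A : zmodType) (chi : D -> A).
Hypothesis D1_infinite : infinite_set [set a : D | a = J a].
Hypothesis chiD : forall x y, x = J x -> y = J y -> chi (x + y) = chi x + chi y.
Hypothesis chiJ : forall c x, c != 0 -> c = J c -> x = J x -> chi (c * x * c) = chi x.

(** Comparing c x c for c = a and c = a + 1 gives chi (a x + x a) = - chi x for
   almost all a. The left side is additive in a and the right side is constant, so
   chi x = 0. *)
Lemma jordan_invariant_eq0 x : x = J x -> chi x = 0.
Proof.
move=> xJ.
have anti a : a != 0 -> a != -1 -> a = J a -> chi (a * x + x * a) = - chi x.
  move=> a0 a1 aJ.
  have sJ : a * x + x * a = J (a * x + x * a).
    by rewrite invoD !invoM -aJ -xJ addrC.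
  have aaJ : a * x * a = J (a * x * a) by rewrite !invoM -aJ -xJ mulrA.
  have a1J : a + 1 = J (a + 1) by rewrite invoD -aJ invo1.
  have := chiJ _ a1J xJ; rewrite addr_eq0 => /(_ a1).
  have -> : (a + 1) * x * (a + 1) = a * x * a + (a * x + x * a) + x.
    by rewrite mulrDl mul1r mulrDr mulr1 mulrDl -!addrA; congr (_ + _); rewrite addrCA.
  move: (a * x + x * a) sJ => q sJ.
  rewrite !chiD ?chiJ //; last by rewrite invoD -sJ -aaJ.
  move/(canRL (addrK _)); rewrite subrr => /eqP.
  by rewrite addrC addr_eq0 => /eqP.
have [a aJ na] := infinite_avoid D1_infinite [:: 0; -1].
move: na; rewrite !inE negb_or => /andP[a0 a1].
have [b bJ nb] := infinite_avoid D1_infinite [:: 0; -1; - a; -1 - a].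
move: nb; rewrite !inE !negb_or => /and4P[b0 b1 ba ba1].
have abJ : a + b = J (a + b) by rewrite invoD -aJ -bJ.
have := anti (a + b); rewrite addrC addr_eq0 => /(_ ba).
have -> : b + a != -1 by apply: contra ba1 => /eqP <-; rewrite addrK.
rewrite addrC => /(_ isT abJ); rewrite mulrDl mulrDr addrACA chiD.
- rewrite !anti // => /(canRL (addKr _)).
  by rewrite opprK subrr => /eqP; rewrite oppr_eq0 => /eqP.
- by rewrite invoD !invoM -aJ -xJ addrC.
- by rewrite invoD !invoM -bJ -xJ addrC.
Qed.
End JordanInvariant.

Section Perfect.
Variables (D : unitRingType) (J : involution D).
Variables (M : lmodType D^c) (h : M -> M -> D).
Hypothesis h_hermitian : delta_hermitian J (-1) h.
Hypothesis h_hyperbolic : hyperbolic J (-1) h.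
Hypothesis D_division : forall a : D, a != 0 -> a \is a GRing.unit.
Hypothesis D1_infinite : infinite_set [set a : D | a = J a].
Notation hDl := (hDl h_hermitian).
Notation hDr := (hDr h_hermitian).
Notation hZl := (hZl h_hermitian).
Notation hZr := (hZr h_hermitian).
Notation hNr := (hNr h_hermitian).
Notation h0l := (h0l h_hermitian).
Notation h0r := (h0r h_hermitian).
Notation hC := (hC h_hermitian).
Notation eichler_data := (eichler_data J h).

Lemma hyperbolic_partner u : u != 0 -> h u u = 0 ->
  exists u', h u u' = 1 /\ h u' u' = 0.
Proof.
move=> u0 uu; have [us [_ usP]] := hyperbolic_isotropic_span h_hermitian h_hyperbolic.
have [v uv] : exists v, h u v != 0.
  apply: contra_notP (negP u0) => nv; apply/eqP/usP => v _.
  rewrite hC (_ : h u v = 0) ?invo0 ?oppr0 //.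
  by apply: contrapT => /eqP ne; apply: nv; exists v.
have {uv}[w uw] : exists w, h u w = 1.
  by exists (v *> (h u v)^-1); rewrite hZr mulrV // D_division.
have [b wwb] := trace_valued h_hyperbolic w.
have wu : h w u = - 1 by rewrite hC uw invo1.
exists (w + u *> b); split; first by rewrite hDr hZr uu mul0r addr0.
rewrite !hDl !hDr !hZl !hZr uu uw wu wwb mul0r mulr0 addr0 mulr1 mulN1r.
by rewrite addrAC subrK subrr.
Qed.

Variables (A : zmodType) (phi : EU J h -> A).
Hypothesis phiM : forall x y, phi (x * y)%g = phi x + phi y.

Lemma phi1 : phi 1%g = 0.
Proof. by apply: (addIr (phi 1%g)); rewrite -phiM mul1g add0r. Qed.

Lemma phiJ x g : phi (g * x * g^-1)%g = phi x.
Proof.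
by rewrite !phiM addrAC -phiM mulgV phi1 add0r.
Qed.

(** The value 0 on invalid data makes this a function of the data alone, free of
   proofs. *)
Definition phiE u w a : A :=
  if pselect (eichler_data u w a) is left d then phi (eichler_EU h_hermitian d) else 0.

Lemma phi_eichler u w a (d : eichler_data u w a) :
  phi (eichler_EU h_hermitian d) = phiE u w a.
Proof.
rewrite /phiE; case: pselect => // d'; congr phi; exact: EU_inj.
Qed.

Lemma phiE_eq u w a u' w' a' : eichler_data u w a -> eichler_data u' w' a' ->
  eichler_map h u w a =1 eichler_map h u' w' a' -> phiE u w a = phiE u' w' a'.
Proof.
by move=> d d' e; rewrite -(phi_eichler d) -(phi_eichler d'); congr phi; exact: EU_inj.
Qed.

Lemma phiED u w w' a a' : eichler_data u w a -> eichler_data u w' a' ->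
  phiE u (w + w') (a + a' + h w w') = phiE u w a + phiE u w' a'.
Proof.
move=> d d'; rewrite -(phi_eichler (eichler_dataD h_hermitian d d')).
rewrite -(phi_eichler d) -(phi_eichler d') -phiM; congr phi.
by apply: EU_inj => v; rewrite /= -(eichler_mapM h_hermitian _ d d').
Qed.

(** phi is invariant under conjugation, and g E(u, w, a) g^-1 = E(g u, g w, a). *)
Lemma phiE_conj (g : EU J h) u w a : eichler_data u w a ->
  eichler_data (val (val g) u) (val (val g) w) a /\
  phiE (val (val g) u) (val (val g) w) a = phiE u w a.
Proof.
move=> d; have /asboolP[_ gD gZ gh] := valP (val g).
have d' : eichler_data (val (val g) u) (val (val g) w) a.
  by case: d => uu uw aw; split; rewrite gh.
split=> //; rewrite -(phi_eichler d) -(phi_eichler d') -[RHS](phiJ _ g); congr phi.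
apply: EU_inj => v.
have gE x : eichler_map h (val (val g) u) (val (val g) w) a (val (val g) x) =
    val (val g) (eichler_map h u w a x).
  by rewrite /eichler_map !gD !gZ !gh.
have gK : val (val g) (val (val g^-1)%g v) = v by exact: unitary_can.
rewrite -[X in _ = X]/(val (val g) (eichler_map h u w a (val (val g^-1)%g v))).
by rewrite -gE gK.
Qed.

Section Dilation.
Variables (u u' : M) (c : D).
Hypotheses (uu : h u u = 0) (uu' : h u u' = 1) (u'u' : h u' u' = 0).
Hypotheses (c0 : c != 0) (cJ : c = J c).

(** The product of the transvections along u, u' and u with parameters b, b^-1
   and b. *)
Lemma weyl_ex (b : D) : b != 0 -> b = J b -> exists g : EU J h,
  [/\ val (val g) u = - (u' *> b^-1), val (val g) u' = u *> b
    & forall w, h u w = 0 -> h u' w = 0 -> val (val g) w = w].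
Proof.
move=> b0 bJ; have ub := D_division b0.
have u'u : h u' u = - 1 by rewrite hC uu' invo1.
have bVJ : b^-1 = J b^-1 by rewrite invoV // -bJ.
pose s := eichler_EU h_hermitian (transvection_data h_hermitian uu bJ).
pose t := eichler_EU h_hermitian (transvection_data h_hermitian u'u' bVJ).
have sE v : val (val s) v = v + u *> (b * h u v).
  by rewrite /= /eichler_map rscale0 h0l addr0 add0r.
have tE v : val (val t) v = v + u' *> (b^-1 * h u' v).
  by rewrite /= /eichler_map rscale0 h0l addr0 add0r.
exists (s * t * s)%g; split=> [||w uw u'w].
- rewrite -[LHS]/(val (val s) (val (val t) (val (val s) u))).
  rewrite (sE u) uu mulr0 rscaler0 addr0 tE u'u sE hDr uu hZr uu' add0r mul1r.
  by rewrite mulrN1 mulrN mulrV // !rscaleN rscale1 addrAC subrr add0r.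
- rewrite -[LHS]/(val (val s) (val (val t) (val (val s) u'))).
  rewrite (sE u') uu' mulr1 tE hDr u'u' hZr u'u add0r mulN1r mulrN mulVr //.
  rewrite rscaleN rscale1 addrAC subrr add0r.
  by rewrite sE hZr uu mul0r mulr0 rscaler0 addr0.
- rewrite -[LHS]/(val (val s) (val (val t) (val (val s) w))).
  by rewrite (sE w) uw mulr0 rscaler0 addr0 tE u'w mulr0 rscaler0 addr0 sE uw
     mulr0 rscaler0 addr0.
Qed.

(** The Weyl elements for c and for -1 compose to the isometry with u |-> u c and
   u' |-> u' c^-1 that is the identity on the orthogonal complement of u and u'.
   The vector u b corrects for w having a component along u. *)
Lemma dilation_ex : exists g : EU J h, val (val g) u = u *> c /\
  forall w, h u w = 0 -> exists2 b, val (val g) w = w + u *> b & w = 0 -> b = 0.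
Proof.
have N1J : -1 = J (-1) by rewrite invoN invo1.
have N10 : -1 != 0 :> D by rewrite oppr_eq0 oner_neq0.
have [g [gu gu' gw]] := weyl_ex c0 cJ; have [k [ku ku' kw]] := weyl_ex N10 N1J.
have /asboolP[_ gD gZ _] := valP (val g); have /asboolP[_ kD kZ _] := valP (val k).
have gkE v : val (val (g * k)%g) v = val (val g) (val (val k) v) by [].
have gku : val (val (g * k)%g) u = u *> c.
  by rewrite gkE ku invrN invr1 rscaleN rscale1 opprK gu'.
exists (g * k)%g; split=> // w uw.
pose b := - h u' w; pose w1 := w - u *> b.
have uw1 : h u w1 = 0 by rewrite hDr hNr hZr uu mul0r oppr0 addr0.
have u'w1 : h u' w1 = 0.
  by rewrite hDr hNr hZr [h u' u]hC uu' invo1 mulN1r !opprK addrN.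
exists (c * b - b) => [|w0].
  rewrite -{1}(subrK (u *> b) w) -/w1 [LHS]gkE kD gD kw // gw // kZ gZ -gkE gku.
  by rewrite /w1 -addrA; congr (_ + _); rewrite rscaleDr rscaleN rscaleA addrC.
by rewrite /b w0 h0r oppr0 mulr0 subrr.
Qed.

(** The Eichler transformation along u c with vector w + u b is the one along u with
   vector w c. *)
Lemma phiE_dilation w a : eichler_data u w a -> exists b,
  [/\ w = 0 -> b = 0, eichler_data u (w *> c) (b * c + c * J b + c * a * c)
    & phiE u (w *> c) (b * c + c * J b + c * a * c) = phiE u w a].
Proof.
move=> d; have [_ uw aw] := d.
have [g [gu gw]] := dilation_ex; have [b gwb b0] := gw w uw.
have [d' <-] := phiE_conj g d; rewrite gu gwb in d' *.
have d'' : eichler_data u (w *> c) (b * c + c * J b + c * a * c).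
  split=> //; first by rewrite hZr uw mul0r.
  rewrite hZl hZr -aw -cJ !invoD !invoM invoK -cJ.
  rewrite [b * c + _]addrC opprD addrACA subrr add0r.
  by rewrite mulrBl mulrBr !mulrA.
exists b; split=> //; apply: phiE_eq => // v; rewrite /eichler_map.
rewrite !hZl !hDl -cJ !hZl.
rewrite !(rscaleDl, rscaleDr, rscaleA, mulrDl, mulrDr, mulrA, addrA).
by do 2!congr (_ + _); rewrite addrAC.
Qed.
End Dilation.

Lemma phiE_transvection u x : h u u = 0 -> x = J x -> phiE u 0 x = 0.
Proof.
move=> uu; have [->|u0] := eqVneq u 0.
  move=> xJ; rewrite -(phi_eichler (transvection_data h_hermitian (h0l 0) xJ)) -phi1.
  congr phi; apply: EU_inj => v; rewrite /= /eichler_map !h0l rscale0.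
  by rewrite rscale0 !addr0.
have [u' [uu' u'u']] := hyperbolic_partner u0 uu.
apply: (jordan_invariant_eq0 (chi := phiE u 0) D1_infinite) => [y z yJ zJ|c y c0 cJ yJ].
  rewrite -phiED; try exact: transvection_data.
  by rewrite h0l !addr0.
have [b [/(_ erefl) b0 _]] :=
  phiE_dilation uu uu' u'u' c0 cJ (transvection_data h_hermitian uu yJ).
by rewrite b0 rscale0 invo0 mul0r mulr0 !add0r.
Qed.

Lemma phiE_uniq u w a a' : eichler_data u w a -> eichler_data u w a' ->
  phiE u w a = phiE u w a'.
Proof.
move=> d d'; have [uu _ aw] := d; have [_ _ aw'] := d'.
have aE : a = h w w + J a by rewrite -aw subrK.
have aE' : a' = h w w + J a' by rewrite -aw' subrK.
have sJ : a - a' = J (a - a').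
  by rewrite {1}aE {1}aE' opprD addrACA subrr add0r invoD invoN.
rewrite -[RHS]addr0 -(phiE_transvection uu sJ) -phiED //; last exact: transvection_data.
by rewrite h0r !addr0; congr phiE; rewrite addrC subrK.
Qed.

(** By [phiE_uniq] the value depends only on w, and it is additive in w and the
   same for v and v c. With v = w (c - 1)^-1 it is therefore 0 on
   w = v c - v. *)
Lemma phiE_eq0 u w a : eichler_data u w a -> phiE u w a = 0.
Proof.
move=> d; have [uu uw aw] := d; have [u0|u0] := eqVneq u 0.
  rewrite -(phi_eichler d) -phi1; congr phi; apply: EU_inj => v.
  by rewrite /= /eichler_map u0 h0l rscale0 rscaler0 !addr0.
have [u' [uu' u'u']] := hyperbolic_partner u0 uu.
have [c cJ cn] := infinite_avoid D1_infinite [:: 0; 1].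
move: cn; rewrite !inE negb_or => /andP[c0 c1].
pose k := (c - 1)^-1; have uc : c - 1 \is a GRing.unit.
  by apply: D_division; rewrite subr_eq0.
have kJ : J k = k by rewrite invoV // invoD invoN invo1 -cJ.
pose v := w *> k.
have dv : eichler_data u v (k * a * k).
  split=> //; first by rewrite hZr uw mul0r.
  by rewrite hZl hZr -aw !invoM kJ mulrBl mulrBr !mulrA.
have [b [_ dvc vc]] := phiE_dilation uu uu' u'u' c0 cJ dv.
have dN := eichler_dataV h_hermitian dv.
have wE : v *> c - v = w.
  by rewrite -{2}[v]rscale1 -rscaleN -rscaleDr rscaleA mulVr // rscale1.
have dw := eichler_dataD h_hermitian dvc dN; rewrite wE in dw.
rewrite (phiE_uniq d dw) -{1}wE phiED // vc -phiED // subrr phiE_transvection //.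
by have [_ _] := eichler_dataD h_hermitian dv dN; rewrite subrr h0l => /subr0_eq.
Qed.
End Perfect.

Section PerfectEU.
Variables (D : unitRingType) (J : involution D).
Variables (M : lmodType D^c) (h : M -> M -> D).
Hypothesis h_hermitian : delta_hermitian J (-1) h.
Hypothesis h_hyperbolic : hyperbolic J (-1) h.
Hypothesis D_division : forall a : D, a != 0 -> a \is a GRing.unit.
Hypothesis D1_infinite : infinite_set [set a : D | a = J a].

Lemma in_EU_conj (f g : unitary h) :
  @in_EU _ J _ h f -> @in_EU _ J _ h (g * f * g^-1)%g.
Proof.
move=> /asboolP fE; apply/asboolP => K KE K1 KM KV KJ.
by apply: (KJ); exact: fE.
Qed.

Definition EU_conj (g : unitary h) (k : EU J h) : EU J h :=
  exist (fun f => is_true (@in_EU _ J _ h f)) _ (in_EU_conj g (valP k)).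

Lemma EU_conjM g k l : EU_conj g (k * l)%g = (EU_conj g k * EU_conj g l)%g.
Proof. by apply: val_inj; rewrite /= !mulgA mulgVK. Qed.

(** EU(M) is a normal closure, so the property proved by induction must be stable
   under conjugation by U(M); this is why it quantifies over all psi. *)
Lemma EU_perfect (A : zmodType) (phi : EU J h -> A) :
  (forall x y, phi (x * y)%g = phi x + phi y) -> forall x, phi x = 0.
Proof.
move=> phiM x.
pose K : set (unitary h) := [set f | exists2 k : EU J h, val k = f &
  forall psi : EU J h -> A,
    (forall x y, psi (x * y)%g = psi x + psi y) -> psi k = 0].
suff [k kx k0] : K (val x) by rewrite -(val_inj kx) k0.
have /asboolP/(_ K) := valP x; apply=> [f [u [w [a [uu uw aw fE]]]]||f g|f|f g].
- exists (eichler_EU h_hermitian (And3 uu uw aw)) => [|psi psiM].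
    apply: val_inj; apply/funext => v.
    by rewrite fE /= /eichler_map rscaleDr addrA rscaleA.
  rewrite phi_eichler; exact: phiE_eq0.
- by exists 1%g => // psi; exact: phi1.
- move=> [k <- k0] [l <- l0]; exists (k * l)%g => // psi psiM.
  by rewrite psiM k0 // l0 // addr0.
- move=> [k <- k0]; exists k^-1%g => // psi psiM.
  by apply: (addrI (psi k)); rewrite -psiM mulgV phi1 // k0 // addr0.
- move=> [k <- k0]; exists (EU_conj g k) => // psi psiM.
  apply: (k0 (psi \o EU_conj g)) => y z /=.
  by rewrite EU_conjM psiM.
Qed.
End PerfectEU.

(** * Cocycles on the edges of a graph with common neighbours *)

Section ConnectedEdges.
Variables (V : eqType) (e : V -> V -> Prop).
Hypothesis e_sym : forall x y, e x y -> e y x.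
Hypothesis e_common : forall s : seq V, exists v, forall x, x \in s -> e v x.

(** Any two vertices have a common neighbour. *)
Lemma edge_const (T : Type) (f : V -> T) :
  (forall x y, e x y -> f x = f y) -> forall x y, f x = f y.
Proof.
move=> ef x y; have [v vP] := e_common [:: x; y].
rewrite -(ef v x); last by apply: vP; rewrite !inE eqxx.
by apply: ef; apply: vP; rewrite !inE eqxx orbT.
Qed.

(** The cohomology of degree 1 of the flag complex vanishes: t x is the sum of q
   along a path o, n x, x of length 2, and a common neighbour w of all the vertices
   involved shows that the choice of n x does not matter. *)
Lemma edge_cocycle_coboundary (A : zmodType) (q : V -> V -> A) :
  (forall x y z, e x y -> e y z -> e x z -> q x y + q y z = q x z) ->
  exists t : V -> A, forall x y, e x y -> q x y = t y - t x.
Proof.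
move=> qP; have [o _] := e_common [::].
have [n nP] := choice (fun x => e_common [:: o; x]).
have no x : e o (n x) by apply: e_sym; apply: (nP x); rewrite !inE eqxx.
have nx x : e (n x) x by apply: (nP x); rewrite !inE eqxx orbT.
exists (fun x => q o (n x) + q (n x) x) => x y xy.
have [w wP] := e_common [:: o; x; y; n x; n y].
have we z : z \in [:: o; x; y; n x; n y] -> e w z /\ e z w.
  by move=> zs; split; [exact: wP | apply/e_sym/wP].
have tE z : z \in [:: o; x; y] -> n z \in [:: o; x; y; n x; n y] ->
    q o (n z) + q (n z) z = q o w + q w z.
  move=> zs nzs; have [wz _] : e w z /\ e z w.
    by apply: we; rewrite (mem_subseq _ zs) // (prefix_subseq [:: o; x; y]).
  have [wnz _] := we _ nzs; have [_ ow] := we o (mem_head _ _).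
  by rewrite -(qP o w (n z)) // -addrA (qP w (n z) z).
rewrite !tE ?inE ?eqxx ?orbT // opprD addrACA subrr add0r.
have [[wx _] [wy _]] : (e w x /\ e x w) /\ (e w y /\ e y w).
  by split; apply: we; rewrite !inE eqxx ?orbT.
by rewrite -(qP w x y) // addrAC subrr add0r.
Qed.
End ConnectedEdges.

(** * Changing the coefficients of group cohomology *)

(** In positive degree the extra disjunct of [coboundary] is the case of the zero
   cochain. *)
Lemma coboundaryS (K : cochain_complex) n (z : cocycles K n.+1) :
  z \in @coboundary K n.+1 <-> exists2 b : K, b \in deg n & diff b = val z.
Proof.
split=> [/orP[/eqP->|/asboolP[k [b [kn bk db]]]]|[b bn db]].
- by exists 0; [have [] := @deg_zmod_closed K n | rewrite raddf0].
- by exists b => //; case: kn bk => ->.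
- by apply/orP; right; apply/asboolP; exists n, b.
Qed.

Lemma gdegP (G : groupType) (A : zmodType) n (f : gcomplex G A) : f \in deg n <->
  (forall s, size s <> n.+1 -> f s = 0) /\
  (forall k s, f [seq (k * x)%g | x <- s] = f s).
Proof. by split=> [/asboolP //|fP]; exact/asboolP. Qed.

Section Lifting.
Variables (G : groupType) (A B : zmodType) (phi : {additive A -> B}).
Hypothesis phi_inj : injective phi.

Lemma lift_cochain n (f : gcomplex G B) : f \in deg n ->
  (forall s, exists a, phi a = f s) ->
  exists2 f' : gcomplex G A, f' \in deg n & coef_cochain phi f' = f.
Proof.
move=> fn ff; have [f' f'E] := choice ff; exists f'; last exact/funext.
have [f0 fG] := (gdegP n f).1 fn.
apply/gdegP; split=> [s ns|k s]; apply: phi_inj; first by rewrite f'E f0 // raddf0.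
by rewrite !f'E fG.
Qed.

Lemma coef_cochain_inj : injective (coef_cochain (G := G) phi).
Proof.
move=> f g fg; apply/funext => s; apply: phi_inj.
exact: (congr1 (fun k : gcomplex G B => k s) fg).
Qed.

(** As phi is injective, the cochain that lifts z - d b value by value is unique,
   hence again invariant and closed. *)
Lemma coef_hom_lift n (z : cocycles (gcomplex G B) n.+1) (b : gcomplex G B) :
  b \in deg n -> (forall s, exists a, phi a = (val z - diff b) s) ->
  exists m, coef_hom phi m = cclass z.
Proof.
move=> bn zb; have /andP[zn /eqP dz] := valP z.
have [d0 dB] := @deg_zmod_closed (gcomplex G B) n.+1.
have [f fn fE] := lift_cochain (dB _ _ zn (diff_deg bn)) zb.
have df : diff f = 0.
  apply: coef_cochain_inj; rewrite coef_cochain_diff fE raddfB dz (diffK bn) subrr.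
  by rewrite raddf0.
have fc : cocycle n.+1 f by rewrite /cocycle fn df eqxx.
exists (cclass (exist (fun f => is_true (cocycle n.+1 f)) f fc)).
rewrite /coef_hom cohomology_mapE; apply/cclassP/coboundaryS; exists (- b).
  have [d0' dB'] := @deg_zmod_closed (gcomplex G B) n.
  by rewrite -sub0r; exact: dB'.
by rewrite raddfN raddfB /= fE addrAC subrr sub0r.
Qed.

(** If the images of z and z' differ by the coboundary of b, then b(1, x) modulo A
   is a homomorphism from G to B / A; the hypothesis says that it is trivial, and b
   then takes values in A. *)
Lemma coef_hom_inj :
  (forall b : G -> B, (forall x y, exists a, phi a = b x + b y - b (x * y)%g) ->
    forall x, exists a, phi a = b x) ->
  injective (@coef_hom G A B phi 2).
Proof.
move=> perf m m'; rewrite -[m]reprK -[m']reprK.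
move: (repr m) (repr m') => z z'; rewrite -/(cclass z) -/(cclass z').
rewrite /coef_hom !cohomology_mapE => /cclassP zz'; apply/cclassP.
pose c : gcomplex G A := val z - val z'.
have [b b1 db] : exists2 b : gcomplex G B, b \in deg 1%N & diff b = coef_cochain phi c.
  by have [b b1 db] := (coboundaryS _).1 zz'; exists b;
    rewrite // db raddfB [RHS](raddfB (coef_cochain phi)).
have [b0 bG] := (gdegP 1 b).1 b1.
have bE x y : b [:: x; y] = b [:: 1%g; x^-1 * y]%g.
  by rewrite -(bG x [:: 1%g; x^-1 * y]%g) /= mulg1 mulgA mulgV mul1g.
have im x : exists a, phi a = b [:: 1%g; x].
  apply: (perf (fun x => b [:: 1%g; x])) => {}x y; exists (c [:: 1; x; x * y]%g).
  have -> : phi (c [:: 1; x; x * y]%g) = diff b [:: 1; x; x * y]%g by rewrite db.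
  rewrite /= /gdiff !altsum_cons altsum_nil /= (bE x) mulgA mulVg mul1g.
  by rewrite subr0 opprB addrA [b [:: 1%g; y] + _]addrC.
have [b' b'1 b'E] : exists2 b', b' \in deg 1%N & coef_cochain phi b' = b.
  apply: lift_cochain => // -[|x [|y [|w s]]]; try by exists 0; rewrite raddf0 b0.
  by have [a aE] := im (x^-1 * y)%g; exists a; rewrite aE bE.
apply/coboundaryS; exists b' => //.
by apply: coef_cochain_inj; rewrite coef_cochain_diff b'E db raddfB.
Qed.
End Lifting.

(** * From the graph to the group *)

(** P and Q are the components on P_1 (x) C_0 and on P_0 (x) C_1 of a cochain whose
   coboundary is the difference of the group cocycle c and of the Maslov cocycle.
   The vertices are labelled by the elements of G, and r is an invariant cochain
   whose coboundary is the Maslov cocycle. *)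
Section Transgression.
Variables (G : groupType) (e : G -> G -> Prop) (A : zmodType).
Hypothesis e_sym : forall x y, e x y -> e y x.
Hypothesis e_common : forall s : seq G, exists v, forall x, x \in s -> e v x.
Hypothesis eG : forall k x y, e x y -> e (k * x)%g (k * y)%g.
Variables (c : G -> G -> G -> A) (P Q : G -> G -> G -> A) (r : G -> G -> A).
Hypothesis PG : forall k k0 k1 x, P (k * k0)%g (k * k1)%g (k * x)%g = P k0 k1 x.
Hypothesis QG : forall k g x y, Q (k * g)%g (k * x)%g (k * y)%g = Q g x y.
Hypothesis rG : forall k x y, r (k * x)%g (k * y)%g = r x y.
Hypothesis cP : forall k0 k1 k2 x, c k0 k1 k2 = P k1 k2 x - P k0 k2 x + P k0 k1 x.
Hypothesis PQ : forall k0 k1 x y, e x y -> Q k1 x y - Q k0 x y = P k0 k1 y - P k0 k1 x.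
Hypothesis Qr : forall g x y z, e x y -> e y z -> e x z ->
  Q g x y + Q g y z - Q g x z = - (r x y + r y z - r x z).

(** Q + r is a cocycle on the edges, hence the difference of values of a potential
   t. Correcting P by t makes it independent of the vertex and turns it into an
   invariant cochain on G with coboundary c. *)
Lemma transgression : exists b : G -> G -> A,
  (forall k k0 k1, b (k * k0)%g (k * k1)%g = b k0 k1) /\
  forall k0 k1 k2, c k0 k1 k2 = b k1 k2 - b k0 k2 + b k0 k1.
Proof.
have [t tP] : exists t : G -> A, forall x y, e x y -> Q 1%g x y + r x y = t y - t x.
  apply: edge_cocycle_coboundary => // x y z xy yz xz.
  have /(canRL (subrK _)) Qxyz := Qr 1%g xy yz xz.
  by rewrite addrACA Qxyz opprB addrAC subrK addrC.
have QE g x y : e x y -> Q g x y = t (g^-1 * y)%g - t (g^-1 * x)%g - r x y.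
  move=> xy; rewrite -(QG g^-1%g) mulVg -(rG g^-1%g x y) -tP ?addrK //.
  exact: eG.
pose P' k0 k1 x := P k0 k1 x - (t (k1^-1 * x)%g - t (k0^-1 * x)%g).
have P'c k0 k1 x y : P' k0 k1 x = P' k0 k1 y.
  move: x y; apply: (edge_const e_common) => x y xy.
  have := PQ k0 k1 xy; rewrite !QE // /P' => e1.
  rewrite -[P k0 k1 y](subrK (P k0 k1 x)) -e1 !(opprD, opprK, addrA).
  by rewrite [RHS](ACl (7*2*5*(1*8)*(3*6)*(4*9))) /= !subrr !addNr !addr0.
exists (fun k0 k1 => P' k0 k1 1%g); split=> [k k0 k1|k0 k1 k2].
  rewrite (P'c _ _ 1%g k) /P' -(PG k k0 k1 1%g) !invgM -!mulgA mulVg.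
  by rewrite !mulg1.
rewrite (cP _ _ _ 1%g) /P' !mulg1 !(opprD, opprK, addrA).
by rewrite [RHS](ACl (1*4*7*(2*5)*(3*8)*(6*9))) /= !subrr !addNr !addr0.
Qed.
End Transgression.

(** * The Maslov cocycle modulo II *)

Section MaslovModII.
Variables (D : unitRingType) (J : involution D).
Variables (M : lmodType D^c) (h : M -> M -> D).
Hypothesis D_division : forall a : D, a != 0 -> a \is a GRing.unit.
Hypothesis D1_infinite : infinite_set [set a : D | a = J a].
Hypothesis h_hermitian : delta_hermitian J (-1) h.
Hypothesis h_hyperbolic : hyperbolic J (-1) h.
Variables (n : nat) (e : 'I_n -> M) (X0 : lagrangian h).
Hypothesis e_basis : basis_of e (val X0).

Local Notation EU := (EU J h).

Definition orbit_lagrangian (g : EU) : lagrangian h := lagrangian_act (val g) X0.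
Definition orbit_basis (g : EU) (i : 'I_n) : M := val (val g) (e i).
Definition orbit_edge (g g' : EU) : Prop :=
  opposite (orbit_lagrangian g) (orbit_lagrangian g').

Lemma orbit_lagrangianM (k g : EU) :
  orbit_lagrangian (k * g)%g = lagrangian_act (val k) (orbit_lagrangian g).
Proof. exact: lagrangian_actM. Qed.

Lemma orbit_basisP g : basis_of (orbit_basis g) (val (orbit_lagrangian g)).
Proof.
have /asboolP[bg gD gZ _] := valP (val g); have [ei eX] := e_basis.
have g0 : val (val g) 0 = 0 by apply: (addIr (val (val g) 0)); rewrite -gD !add0r.
have gE c : lincomb (orbit_basis g) c = val (val g) (lincomb e c).
  by rewrite (big_morph _ gD g0); apply: eq_bigr => i _; rewrite gZ.
split=> [c d|]; first by rewrite !gE => /(bij_inj bg)/ei.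
rewrite /= -eX; apply/seteqP; split=> [_ [c _ <-]|_ [_ [c _ <-] <-]].
  by exists (lincomb e c); [exists c | rewrite gE].
by exists c; rewrite ?gE.
Qed.

Lemma orbit_edge_sym g g' : orbit_edge g g' -> orbit_edge g' g.
Proof. exact: opposite_sym. Qed.

Lemma orbit_edgeG k g g' : orbit_edge g g' -> orbit_edge (k * g)%g (k * g')%g.
Proof. by rewrite /orbit_edge !orbit_lagrangianM; exact: lagrangian_act_opposite. Qed.

Lemma orbit_edge_common (s : seq EU) : exists v, forall g, g \in s -> orbit_edge v g.
Proof.
have [v vP] := common_opposite h_hermitian D_division D1_infinite h_hyperbolic X0
                 [seq orbit_lagrangian g | g <- s].
by exists v => g gs; apply: vP; exact: map_f.
Qed.

Definition orbit_gram (g g' : EU) : 'M[D]_n := gram h (orbit_basis g) (orbit_basis g').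
(** Some value of the determinant of the Gram matrix; as it is chosen from the
   matrix alone, it is invariant under EU(M). *)
Definition orbit_det (g g' : EU) : K1 D := xget 0 [set d | has_det (orbit_gram g g') d].

Lemma orbit_detP g g' : orbit_edge g g' -> has_det (orbit_gram g g') (orbit_det g g').
Proof.
move=> gg'; have [d hd] := gram_opposite h_hermitian D_division (orbit_basisP g)
                            (orbit_basisP g') gg'.
exact: (xgetPex 0 (ex_intro _ d hd)).
Qed.

Lemma orbit_detG k g g' : orbit_det (k * g)%g (k * g')%g = orbit_det g g'.
Proof.
rewrite /orbit_det (_ : orbit_gram _ _ = orbit_gram g g') //.
by apply/matrixP => i j; rewrite !mxE; have /asboolP[_ _ _ ->] := valP (val k).
Qed.

Lemma orbit_maslov x y z : orbit_edge x y -> orbit_edge y z -> orbit_edge x z ->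
  let d := orbit_det x y + orbit_det y z - orbit_det x z in
  d \in form_dets J /\
  witt_pi (maslov J (orbit_lagrangian x) (orbit_lagrangian y) (orbit_lagrangian z)) =
    witt_pi (wclass (form1 J)) *+ n + det_disc J d.
Proof.
move=> xy yz xz.
exact: (disc_maslov h_hermitian D_division (orbit_basisP x) (orbit_basisP y)
  (orbit_basisP z) xy yz xz (orbit_detP xy) (orbit_detP yz) (orbit_detP xz)).
Qed.

(** A potential of the cocycle [orbit_det] in K_1(D) / Sigma is a homomorphism on
   EU(M) up to a constant, hence constant. *)
Lemma orbit_det_form_dets x y : orbit_edge x y -> orbit_det x y \in form_dets J.
Proof.
pose Q := Quotient.quot (form_dets J).
pose q x y : Q := \pi_Q (orbit_det x y).
have q_eq0 d : (\pi_Q d == 0 :> Q) = (d \in form_dets J).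
  by rewrite -(raddf0 \pi_Q) -Quotient.idealrBE subr0.
have [t tP] : exists t : EU -> Q, forall x y, orbit_edge x y -> q x y = t y - t x.
  apply: (edge_cocycle_coboundary orbit_edge_sym orbit_edge_common).
  move=> {}x {}y z xy yz xz.
  apply/eqP; rewrite -subr_eq0 -raddfD -raddfB q_eq0.
  by have [] := orbit_maslov xy yz xz.
have tc k x' y' : t (k * x')%g - t x' = t (k * y')%g - t y'.
  move: x' y'; apply: (edge_const orbit_edge_common) => x' y' xy.
  have := tP _ _ (orbit_edgeG k xy); rewrite /q orbit_detG -/(q x' y') tP //.
  move=> e1; apply/eqP; rewrite eq_sym subr_eq addrAC eq_sym -addrA e1.
  by rewrite addrC subrK.
have t0 : forall k, t k - t 1%g = 0.
  apply: (EU_perfect h_hermitian h_hyperbolic D_division D1_infinite) => k l.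
  by have := tc k l 1%g; rewrite mulg1 => <-; rewrite addrA subrK.
move=> xy; rewrite -q_eq0 -/(q x y) tP // -(subrK (t 1%g) (t y)) t0 add0r.
by rewrite -opprB t0 oppr0.
Qed.

(** Now that [orbit_det] lies in Sigma, [det_disc] applies to each of the three
   summands of the determinant of the form kappa. *)
Lemma maslov_mod_II_coboundary : exists r : EU -> EU -> witt_mod J,
  (forall k x y, r (k * x)%g (k * y)%g = r x y) /\
  forall x y z, orbit_edge x y -> orbit_edge y z -> orbit_edge x z ->
    witt_pi (maslov J (orbit_lagrangian x) (orbit_lagrangian y) (orbit_lagrangian z)) =
    r x y + r y z - r x z.
Proof.
pose o := witt_pi (wclass (form1 J)) *+ n.
exists (fun x y => o + det_disc J (orbit_det x y)); split=> [k x y|x y z xy yz xz].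
  by rewrite orbit_detG.
have [ds ->] := orbit_maslov xy yz xz.
have [sxy syz] := (orbit_det_form_dets xy, orbit_det_form_dets yz).
have sxz := orbit_det_form_dets xz.
rewrite -/o; set d := orbit_det x y + orbit_det y z - orbit_det x z in ds *.
have -> : det_disc J d = det_disc J (orbit_det x y) + det_disc J (orbit_det y z)
    - det_disc J (orbit_det x z).
  apply: (canRL (addrK _)); rewrite -(det_discD D_division sxy syz).
  by rewrite -(det_discD D_division ds sxz) /d subrK.
rewrite !(opprD, opprK, addrA).
by rewrite [RHS](ACl (1*2*4*6*(3*5))) /= subrr addr0.
Qed.
End MaslovModII.

(** * The reduced Maslov class *)

Section Reduction.
Variables (D : unitRingType) (J : involution D).
Variables (M : lmodType D^c) (h : M -> M -> D).
Hypothesis D_division : forall a : D, a != 0 -> a \is a GRing.unit.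
Hypothesis D1_infinite : infinite_set [set a : D | a = J a].
Hypothesis h_hermitian : delta_hermitian J (-1) h.
Hypothesis h_hyperbolic : hyperbolic J (-1) h.

Lemma II_inclP (w : witt J) : (exists a, II_incl J a = w) <-> witt_pi w = 0.
Proof.
rewrite witt_pi_eq0; split=> [[a <-]|wI]; first exact: valP a.
by exists (exist (fun x => is_true (zspan (@II_gen D J) x)) w wI).
Qed.

(** The quotient W/II is a trivial module and EU(M) is perfect. *)
Lemma II_coef_inj : injective (@coef_hom (EU J h) _ _ (II_incl J) 2).
Proof.
apply: coef_hom_inj => [|b bM x]; first exact: val_inj.
apply/II_inclP; move: x.
apply: (EU_perfect h_hermitian h_hyperbolic D_division D1_infinite) => x y.
have /II_inclP := bM x y; rewrite raddfB raddfD /= => /eqP.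
by rewrite subr_eq0 => /eqP ->.
Qed.

(** The equation that makes g represent the Maslov class has components b2 and b3
   on P_1 (x) C_1 and on P_0 (x) C_2; the component on P_2 (x) C_0 expresses g by
   b. Modulo II, [transgression] writes g as the coboundary of c', and lifting c'
   to W corrects g to a cocycle with values in II. *)
Lemma maslov_class_lift :
  exists m, coef_hom (II_incl J) m = res_hom (EU_incl J h) (maslov_class J h).
Proof.
(* If no class maps to that of the Maslov cocycle, the Maslov class is 0. *)
rewrite /maslov_class; case: xgetP => [c _ [z [zE cz]]|_]; last first.
  have c0 (G : groupType) (B : zmodType) : cclass 0 = 0 :> gcohomology G B 2.
    exact: raddf0.
  exists (cclass 0); rewrite -c0 /coef_hom /res_hom !cohomology_mapE.
  by congr cclass; apply: val_inj; rewrite /= !raddf0.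
rewrite -[c]reprK -/(cclass _) /res_hom cohomology_mapE.
move: cz; rewrite /aug_hom /cohomology_map; set g := repr c.
move=> /cclassP/coboundaryS[b b1 db].
pose fn2 := seq (unitary h) -> seq (opposition_graph h) -> witt J.
pose gf : seq (unitary h) -> witt J := val g.
move: (b : fn2) b1 db => {}b b1 db; have /asboolP[b0 bG] := b1.
have {}db s v : eqdiff b s v =
    (@aug_cochain _ (opposition_graph h) _ (val g) : fn2) s v -
    (maslov_cochain J (h := h) : fn2) s v.
  move/(congr1 (fun f : fn2 => f s v)): db.
  by rewrite raddfB /= zE.
have bnil s : b s [::] = 0 by apply: b0; rewrite andbF.
have bnil' v : b [::] v = 0 by exact: b0.
have gE k0 k1 k2 (X : opposition_graph h) : gf [:: k0; k1; k2] =
    b [:: k1; k2] [:: X] - b [:: k0; k2] [:: X] + b [:: k0; k1] [:: X].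
  have := db [:: k0; k1; k2] [:: X]; rewrite /eqdiff flag1 !altsum_cons !altsum_nil.
  by rewrite /gf /= bnil !subr0 mul0rz addr0 /aug_cochain /= opprB addrA addrAC => <-.
have b2 k0 k1 (X Y : opposition_graph h) : opposite X Y ->
    b [:: k1] [:: X; Y] - b [:: k0] [:: X; Y] =
    b [:: k0; k1] [:: Y] - b [:: k0; k1] [:: X].
  move=> XY; have := db [:: k0; k1] [:: X; Y]; rewrite /eqdiff.
  have -> : flag [:: X; Y].
    apply/asboolP => U V; rewrite !inE.
    by do 2!case/orP=> /eqP->; [left|right|right; exact: opposite_sym|left].
  rewrite !altsum_cons !altsum_nil /aug_cochain /= !subr0 expr1 mulrN1z => /eqP.
  by rewrite addr_eq0 opprK => /eqP.
have b3 k (X Y Z : opposition_graph h) : opposite X Y -> opposite Y Z -> opposite X Z ->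
    b [:: k] [:: X; Y] + b [:: k] [:: Y; Z] - b [:: k] [:: X; Z] = - maslov J X Y Z.
  move=> XY YZ XZ; have := db [:: k] [:: X; Y; Z]; rewrite /eqdiff.
  have [YX ZY ZX] := And3 (opposite_sym XY) (opposite_sym YZ) (opposite_sym XZ).
  have -> : flag [:: X; Y; Z].
    apply/asboolP => U V; rewrite !inE.
    by case/or3P=> /eqP->; case/or3P=> /eqP->; (by left) || by right.
  rewrite !altsum_cons !altsum_nil /aug_cochain /= !bnil' !subr0 add0r mulr1z.
  by rewrite opprB addrA sub0r => <-; rewrite [b _ [:: X; Y] + _]addrC.
have [n [e [_ [X0 [be _ _]]]]] := hyperbolic_basis h_hermitian h_hyperbolic.
have [r [rG rP]] := maslov_mod_II_coboundary D_division D1_infinite h_hermitian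
  h_hyperbolic be.
pose X := orbit_lagrangian (J := J) X0.
have bX k s v : b [seq val (k * x)%g | x <- s] [seq X (k * x)%g | x <- v] =
    b [seq val (x : EU J h) | x <- s] [seq X x | x <- v].
  rewrite -[RHS](bG (val k)) -!map_comp; congr b.
  by apply: eq_map => x; exact: orbit_lagrangianM.
pose gbar (k0 k1 k2 : EU J h) := witt_pi (gf [:: val k0; val k1; val k2]).
have [c' [c'G c'P]] : exists c' : EU J h -> EU J h -> witt_mod J,
    (forall k k0 k1, c' (k * k0)%g (k * k1)%g = c' k0 k1) /\
    forall k0 k1 k2, gbar k0 k1 k2 = c' k1 k2 - c' k0 k2 + c' k0 k1.
  apply: (@transgression _ (orbit_edge X0) _ (@orbit_edge_sym _ _ _ _ _) _ _ gbar
    (fun k0 k1 x => witt_pi (b [:: val k0; val k1] [:: X x]))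
    (fun k x y => witt_pi (b [:: val k] [:: X x; X y])) r) => //.
  - exact: orbit_edge_common.
  - exact: orbit_edgeG.
  - by move=> k k0 k1 x; rewrite -(bX k [:: k0; k1] [:: x]).
  - by move=> k k0 x y; rewrite -(bX k [:: k0] [:: x; y]).
  - by move=> k0 k1 k2 x; rewrite /gbar (gE _ _ _ (X x)) raddfD raddfB.
  - by move=> k0 k1 x y xy; rewrite -!raddfB b2.
  - move=> k x y z' xy yz xz; rewrite -rP // -[RHS]raddfN /=.
    by rewrite -(b3 (val k) (X x) (X y) (X z')) // raddfB raddfD.
pose b' : gcomplex (EU J h) (witt J) :=
  fun s => if s is [:: k0; k1] then repr (c' 1 (k0^-1 * k1))%g else 0.
have b'E k0 k1 : witt_pi ((b' : seq (EU J h) -> witt J) [:: k0; k1]) = c' k0 k1.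
  by rewrite witt_pi_repr -(c'G k0) mulg1 mulgA mulgV mul1g.
have b'1 : b' \in deg 1.
  apply/gdegP; split=> [[|k0 [|k1 []]] //|k [|k0 [|k1 []]] //] /=.
  by rewrite invgM mulgA mulgVK.
apply: (coef_hom_lift _ b'1) => [|s]; first exact: val_inj.
set z' := cmap_cocycles _ g; pose f : seq (EU J h) -> witt J := val z' - diff b'.
have f2 : f \in @deg (gcomplex (EU J h) (witt J)) 2.
  have [_ dB] := @deg_zmod_closed (gcomplex (EU J h) (witt J)) 2.
  by apply: dB; [case/andP: (valP z') | exact: diff_deg].
have [f0 _] := (gdegP 2 _).1 f2; apply/II_inclP; rewrite -[_ s]/(f s).
have [s3|s3] := eqVneq (size s) 3; last by rewrite f0 ?raddf0 //; apply/eqP.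
case: s s3 => [|k0 [|k1 [|k2 []]]] // _.
rewrite /f fctB /= /gdiff !altsum_cons altsum_nil subr0 !raddfB /= !b'E.
rewrite -[witt_pi _]/(gbar k0 k1 k2) c'P.
by rewrite !opprK !addrA [LHS](ACl ((1*4)*(2*5)*(3*6))) /= !subrr addNr !addr0.
Qed.
End Reduction.

Theorem theorem7p7 (D : unitRingType)
    (D_division : forall a : D, a != 0 -> a \is a GRing.unit)
    (J : involution D)
    (D1_infinite : infinite_set [set a : D | a = J a]%classic)
    (M : vectType D^c) (h : M -> M -> D)
    (h_hermitian : delta_hermitian J (-1) h)
    (h_hyperbolic : hyperbolic J (-1) h) :
  exists! m : gcohomology (EU J h) (II J) 2,
    coef_hom (II_incl J) m = res_hom (EU_incl J h) (maslov_class J h).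
Proof.
have [m mP] := maslov_class_lift D_division D1_infinite h_hermitian h_hyperbolic.
exists m; split=> // m' m'P.
apply: (II_coef_inj D_division D1_infinite h_hermitian h_hyperbolic).
by rewrite mP m'P.
Qed.
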